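(* Let $m > n \geq 2$ and $0 \le \ell \le m$ be integers. Then there exists a non-empty Zariski open subset $U^{\ell}$ of $\mathcal{V}^{\ell}_{m,n}$ such that for any $x = \sum_{i=1}^m \delta_{v_i} \in U^{\ell}$ the second moment $m_2(x)$ uniquely determines the $\mathrm{O}(n)$-orbit of $x$; that is, if $y \in \mathcal{V}_{m,n}$ satisfies $m_2(y) = m_2(x)$, then $y = g\cdot x$ for some $g \in \mathrm{O}(n)$.
   Context: For $v \in \mathbb{R}^n$, $\delta_v$ denotes the Dirac distribution (unit point mass) at $v$. A binary $\delta$-function is a distribution $x=\sum_{i=1}^m \delta_{v_i}$ with $v_1,\dots,v_m\in\mathbb{R}^n$ distinct. The orthogonal group $\mathrm{O}(n)$ acts by $g\cdot \sum_i \delta_{v_i} = \sum_i \delta_{g v_i}$. $\mathcal{V}_{m,n}$ denotes the set of binary $\delta$-functions supported at $m$ distinct points of $\mathbb{R}^n$. It is parametrized as the quotient of $\mathcal{U}_{m,n} = (\mathbb{R}^n)^m \setminus \Delta$ (the open set of $m$-tuples of distinct points) by the action of the symmetric group $S_m$ permuting the points, and is given the corresponding (quotient) Zariski topology: a subset is Zariski open (closed) iff its preimage in $\mathcal{U}_{m,n}$ is. For $0\le \ell\le m$, $\mathcal{V}^{\ell}_{m,n}$ is the closed subset of $\mathcal{V}_{m,n}$ consisting of those $\sum_i\delta_{v_i}$ for which some subset of at least $\ell$ of the points $v_i$ all have the same magnitude (Euclidean norm); it carries the subspace Zariski topology. The second moment (auto-correlation) of $x=\sum_{i=1}^m\delta_{v_i}$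 is the distribution on $(\mathbb{R}^n)^2$ given by $$m_2(x)(\tau_1,\tau_2) = \int_{\mathrm{O}(n)} (g\cdot x)(\tau_1)\,(g\cdot x)(\tau_2)\,dg = \sum_{i,j=1}^m \int_{\mathrm{O}(n)} (g\cdot\delta_{v_i})(\tau_1)\,(g\cdot \delta_{v_j})(\tau_2)\,dg,$$ where $dg$ is Haar measure; i.e. it is the measure $\varphi \mapsto \sum_{i,j=1}^m \int_{\mathrm{O}(n)} \varphi(gv_i, gv_j)\,dg$ on test functions $\varphi$ on $(\mathbb{R}^n)^2$. *)

(* Defs.v *)
From HB Require Import structures.
From mathcomp Require Import all_boot all_order all_algebra.
From mathcomp Require Import all_classical all_reals all_analysis.
(* The notations of mpoly clash with those of mathcomp-analysis. *)
From mathcomp Require Import -(notations) mpoly.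
Import Order.TTheory GRing.Theory Num.Theory.
Import numFieldNormedType.Exports.

Set Implicit Arguments.
Unset Strict Implicit.
Unset Printing Implicit Defensive.

Local Open Scope classical_set_scope.
Local Open Scope ring_scope.

Definition borel_mx (R : realType) (p q : nat) :=
  g_sigma_algebraType (@open 'M[R]_(p, q)).

HB.instance Definition _ (R : realType) (p q : nat) :=
  Measurable.on (borel_mx R p q).

(* Distributions are positive Borel measures.  They are kept as bare set
   functions; on sets that are not Borel the values carry no information, but
   for sums of Dirac measures (the only distributions on R^n used below) they
   are determined by the values on Borel sets. *)
Definition distr (R : realType) (n : nat) := set (borel_mx R n 1) -> \bar R.

Definition orthogonal_group (R : realType) (n : nat) : set (borel_mx R n n) :=
  [set g : 'M[R]_n | g^T *m g = 1%:M].

Definition orth_act (R : realType) (n : nat) (g : 'M[R]_n) (x : distr R n) :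
    distr R n :=
  pushforward x (fun v : borel_mx R n 1 => g *m v : borel_mx R n 1).

(* A configuration of m points of R^n is the n x m matrix with columns v_i. *)
Definition binary_delta (R : realType) (n m : nat) (v : 'M[R]_(n, m)) :
    distr R n :=
  fun A => (\sum_(i < m) \d_(col i v : borel_mx R n 1) A)%E.

Definition distinct_conf (R : realType) (n m : nat) : set 'M[R]_(n, m) :=
  [set v | injective (fun i : 'I_m => col i v)].

Definition delta_space (R : realType) (n m : nat) : set (distr R n) :=
  @binary_delta R n m @` @distinct_conf R n m.

Definition magnitude (R : realType) (n : nat) (v : 'cV[R]_n) : R :=
  Num.sqrt (\sum_(i < n) v i 0 ^+ 2).

Definition delta_space_eqmag (R : realType) (n m l : nat) :
    set (distr R n) :=
  @binary_delta R n m @` [set v | distinct_conf v /\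
    exists I : {set 'I_m}, (l <= #|I|)%N /\
      forall i j, i \in I -> j \in I ->
        magnitude (col i v) = magnitude (col j v)].

Definition zariski_closed (R : realType) (n m : nat) (Z : set 'M[R]_(n, m)) :=
  exists P : set (mpoly (n * m) R),
    Z = [set v | forall p, P p -> meval (mxvec v 0) p = 0].

Definition zariski_open_conf (R : realType) (n m : nat)
    (W : set 'M[R]_(n, m)) :=
  exists Z, zariski_closed Z /\ W = @distinct_conf R n m `\` Z.

(* The topology of delta_space is the quotient topology: O is open when its
   preimage under binary_delta in the space of distinct configurations is. *)
Definition zariski_open_delta (R : realType) (n m : nat)
    (O : set (distr R n)) :=
  O `<=` @delta_space R n m /\
  zariski_open_conf (@distinct_conf R n m `&` @binary_delta R n m @^-1` O).

Definition zariski_open_eqmag (R : realType) (n m l : nat)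
    (U : set (distr R n)) :=
  exists O, zariski_open_delta m O /\ U = O `&` @delta_space_eqmag R n m l.

(* Normalized Haar measure of O(n), seen as a Borel measure on all n x n
   matrices that is carried by O(n). *)
Definition haar_orthogonal (R : realType) (n : nat)
    (mu : probability (borel_mx R n n) R) :=
  mu (@orthogonal_group R n) = 1%E /\
  forall g : 'M[R]_n, @orthogonal_group R n g ->
  forall A, measurable A ->
    mu ((fun h : borel_mx R n n => g *m h : borel_mx R n n) @^-1` A) = mu A.

(* The integral over O(n) of (g x) \x (g x), a measure on R^n x R^n; for
   x = \sum_i \d_(v_i) it sends a Borel set A to
   \sum_(i, j) mu [set g in O(n) | A (g v_i, g v_j)].  Only its values on
   measurable sets are meaningful. *)
Definition second_moment (R : realType) (n : nat)
    (mu : probability (borel_mx R n n) R) (x : distr R n) :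
    set (borel_mx R n 1 * borel_mx R n 1) -> \bar R :=
  fun A => (\int[mu]_(g in @orthogonal_group R n)
              (orth_act g x \x orth_act g x) A)%E.

(* Main.v *)
Require Import Defs.
From mathcomp Require Import -(notations) mpoly.
From mathcomp Require Import all_boot all_order all_algebra.
From mathcomp Require Import all_classical all_reals all_analysis.
From mathcomp Require Import measurable_realfun perm ring lra.
Import Order.TTheory GRing.Theory Num.Theory.
Import numFieldNormedType.Exports.
Set Implicit Arguments.
Unset Strict Implicit.
Unset Printing Implicit Defensive.
Local Open Scope ring_scope.

(** Since every V^l contains the configurations whose m points all have the
    same magnitude, it is enough to find one Zariski open set O of
    configurations that contains such a configuration and on which the second
    moment determines the orbit; U^l is then the trace of O on V^l.

    Testing the second moment against the O(n)-invariant sets on which the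
    inner product and the sum of the two squared norms are prescribed gives
    the numbers of pairs (i, j) with given values of <v_i, v_j> and
    |v_i|^2 + |v_j|^2 ([second_moment_level]).  If w has the same second moment
    as v, a permutation s of the pairs therefore carries the Gram data of v to
    the Gram data of w.  Distinct pairs have distinct inner products for
    generic v, so that s permutes the edges of the complete graph on the
    points.  It remains to see that s comes from a permutation of the points,
    because configurations with equal Gram matrices differ by an orthogonal
    map ([gram_eq_orthogonal]).

    The Gram matrix of w has rank at most n, so its minors of size n + 1
    vanish: the same minors of the Gram matrix of v with its entries permuted
    by s are zero.  For generic v this forces these polynomials in v to vanish
    at every configuration of unit vectors ([generic]), and special unit
    configurations then constrain s.

    - If s sent the edges inside an (n+1)-set to edges that do not all lie in
      an (n+1)-set, the graph of the images would be so sparse that it can be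
      dismantled by removing vertices of degree less than n
      ([sparse_graph_degenerate]).  Unit vectors with orthogonal end points on
      every edge can then be chosen one after the other
      ([orthogonal_representation]), and the minor is the determinant of the
      identity matrix.  So s maps (n+1)-cliques to (n+1)-cliques
      ([clique_to_clique]).
    - On an (n+1)-set, put an orthonormal basis at n points and a combination
      of it at the last one, so that the Gram matrix is supported on a star.
      Two edges of the star cannot come from disjoint edges, where the minor
      would be a product of two nonzero 2 x 2 determinants
      ([disjoint_to_disjoint]), and three edges of the star cannot come from a
      triangle, whose determinant 1 - x^2 - y^2 - z^2 + 2 x y z = 2 x y z is
      nonzero ([no_star]).  So s maps triangles to triangles, and such an edge
      permutation is induced by the vertices ([edge_perm_induced]).

    Only finitely many polynomials are involved, each nonzero at some
    configuration of unit vectors.  As a product of spheres has a polynomial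
    parametrization up to a common radius ([sphere_map]), they are
    simultaneously nonzero at some configuration of equal magnitudes
    ([generic_equal_norm]). *)

(** * Orthogonal representations of sparse graphs *)

Lemma gramE (R : pzRingType) (n m : nat) (v : 'M[R]_(n, m)) i j :
  (v^T *m v) i j = \sum_k v k i * v k j.
Proof. by rewrite mxE; apply: eq_bigr => k _; rewrite mxE. Qed.

Definition unit_conf (R : pzRingType) (n m : nat) (v : 'M[R]_(n, m)) :=
  forall i, (v^T *m v) i i = 1.

Lemma exists_unit_orthogonal (R : rcfType) (n m : nat) (v : 'M[R]_(n, m))
    (S : {set 'I_m}) : (#|S| < n)%N ->
  exists u : 'I_n -> R, \sum_k u k * u k = 1 /\
    forall p, p \in S -> \sum_k v k p * u k = 0.
Proof.
move=> Sn; pose B : 'M[R]_(n, #|S|) := \matrix_(k, a) v k (enum_val a).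
have : kermx B != 0.
  rewrite -mxrank_eq0 mxrank_ker subn_eq0 -ltnNge.
  exact: leq_ltn_trans (rank_leq_col _) Sn.
case/rowV0Pn => x /sub_kermxP xB x0.
pose N := \sum_k x 0 k * x 0 k.
have N0 : 0 < N.
  rewrite lt_def sumr_ge0 ?andbT; last by move=> k _; rewrite -expr2 sqr_ge0.
  apply: contra x0 => /eqP N0; apply/eqP/rowP => k; rewrite mxE.
  have/psumr_eq0P /(_ N0 k isT) /eqP : forall k, true -> 0 <= x 0 k * x 0 k.
    by move=> k' _; rewrite -expr2 sqr_ge0.
  by rewrite mulf_eq0 orbb => /eqP.
exists (fun k => x 0 k / Num.sqrt N); split.
  rewrite (eq_bigr (fun k => (x 0 k * x 0 k) / N)); last first.
    by move=> k _; rewrite mulrACA -invfM -[Num.sqrt N * _]expr2 sqr_sqrtr ?ltW.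
  by rewrite -mulr_suml mulfV // gt_eqF.
move=> p pS; move/rowP: xB => /(_ (enum_rank_in pS p)); rewrite !mxE => xB.
rewrite (eq_bigr (fun k => (x 0 k * v k p) / Num.sqrt N)); last first.
  by move=> k _; rewrite mulrA [v k p * _]mulrC.
rewrite -mulr_suml; apply/eqP; rewrite mulf_eq0; apply/orP; left; apply/eqP.
by rewrite -[RHS]xB; apply: eq_bigr => k _; rewrite mxE enum_rankK_in.
Qed.

(** Vertices are placed in the reverse of an elimination order: each new unit
    vector only has to avoid fewer than n earlier ones. *)
Lemma orthogonal_representation (R : rcfType) (n m : nat) (r : rel 'I_m) :
    symmetric r ->
    (forall A : {set 'I_m}, A != finset.set0 ->
      exists2 p, p \in A & (#|[set q in A | r p q]| < n)%N) ->
  exists2 v : 'M[R]_(n, m), unit_conf v &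
    forall p q, p != q -> r p q -> (v^T *m v) p q = 0.
Proof.
move=> rC degen.
suff H k (A : {set 'I_m}) : #|A| = k -> exists v : 'M[R]_(n, m),
    (forall p, p \in A -> (v^T *m v) p p = 1) /\
    (forall p q, p \in A -> q \in A -> p != q -> r p q -> (v^T *m v) p q = 0).
  have [v [v1 v0]] := H _ finset.setT erefl; exists v => [p|p q]; first by rewrite v1 ?inE.
  by apply: v0; rewrite inE.
elim: k A => [|k IH] A.
  move/eqP; rewrite cards_eq0 => /eqP->; exists 0.
  by split=> [p|p q]; rewrite inE.
move=> cA; have [|p pA deg] := degen A; first by rewrite -cards_eq0 cA.
have [|v [v1 v0]] := IH (A :\ p)%SET.
  by move: cA; rewrite (cardsD1 p A) pA => -[].
have [u [u1 u0]] := exists_unit_orthogonal v deg.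
pose v' : 'M[R]_(n, m) := \matrix_(k, i) if i == p then u k else v k i.
have E i j : i != p -> j != p -> (v'^T *m v') i j = (v^T *m v) i j.
  move=> /negPf ip /negPf jp; rewrite !gramE.
  by apply: eq_bigr => a _; rewrite !mxE ip jp.
have Ep i : i != p -> (v'^T *m v') i p = \sum_k v k i * u k.
  move=> /negPf ip; rewrite !gramE.
  by apply: eq_bigr => a _; rewrite !mxE ip eqxx.
have EC i j : (v'^T *m v') i j = (v'^T *m v') j i.
  by rewrite !gramE; apply: eq_bigr => a _; rewrite mulrC.
exists v'; split=> [q qA|q q' qA q'A qq' rqq'].
  have [->|qp] := eqVneq q p; last by rewrite E // v1 // !inE qp.
  by rewrite gramE -[RHS]u1; apply: eq_bigr => a _; rewrite !mxE eqxx.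
have [qp|qp] := eqVneq q p.
  have q'p : q' != p by rewrite -qp eq_sym.
  by rewrite EC qp Ep // u0 // !inE q'A -qp.
have [q'p|q'p] := eqVneq q' p.
  by rewrite q'p Ep // u0 // !inE qA rC -q'p.
by rewrite E // v0 // !inE ?qp ?q'p.
Qed.

(** A subgraph of minimal degree at least n has at least n + 1 vertices, hence
    at least (n + 1) n oriented edges; the bound on the number of edges leaves
    room only for the complete graph on n + 1 vertices. *)
Lemma sparse_graph_degenerate (n m : nat) (r : rel 'I_m) : (0 < n)%N ->
    irreflexive r ->
    (#|[set x : 'I_m * 'I_m | r x.1 x.2]| <= n.+1 * n)%N ->
  (exists2 A : {set 'I_m}, #|A| = n.+1 &
     forall p q, r p q -> (p \in A) && (q \in A)) \/
  (forall A : {set 'I_m}, A != finset.set0 ->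
     exists2 p, p \in A & (#|[set q in A | r p q]| < n)%N).
Proof.
move=> n0 rI; set X := finset _ => cX.
case: (boolP [exists A : {set 'I_m}, (A != finset.set0) &&
    [forall p in A, (n <= #|[set q in A | r p q]%SET|)%N]]); last first.
  move=> /existsPn degen; right=> A A0; move: (degen A); rewrite A0 /=.
  by case/forall_inPn => p pA; rewrite -ltnNge; exists p.
case/existsP=> A /andP[/set0Pn[p pA] /forall_inP deg]; left.
pose XA := [set x in X | (x.1 \in A) && (x.2 \in A)]%SET.
have XAX : XA \subset X by apply/fintype.subsetP => x; rewrite inE => /andP[].
have cXA : #|XA| = (\sum_(p in A) #|[set q in A | r p q]%SET|)%N.
  rewrite -sum1_card; under [RHS]eq_bigr do rewrite -sum1_card.
  rewrite pair_big_dep /=; apply: eq_bigl => -[a b]; rewrite !inE /=.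
  by case: (a \in A); case: (b \in A); case: (r a b).
have leXA : (#|A| * n <= #|XA|)%N.
  by rewrite cXA -sum_nat_const; apply: leq_sum => q qA; apply: deg.
(* A contains a vertex together with its neighbours. *)
have cA : (n < #|A|)%N.
  have /subset_leq_card : (p |: [set q in A | r p q]%SET)%SET \subset A.
    by apply/fintype.subsetP => q; rewrite !inE => /orP[/eqP->|/andP[]].
  by rewrite cardsU1 !inE rI andbF add1n; apply: leq_trans; rewrite ltnS deg.
exists A.
  apply/eqP; rewrite eqn_leq cA andbT -(leq_pmul2r n0).
  exact: leq_trans leXA (leq_trans (subset_leq_card XAX) cX).
(* The count is tight, so that no edge leaves A. *)
have /eqP XE : XA == X.
  rewrite eqEcard XAX (leq_trans cX) // (leq_trans _ leXA) //.
  by rewrite leq_pmul2r.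
move=> a b rab; have : (a, b) \in XA by rewrite XE inE.
by rewrite inE => /andP[].
Qed.

(** * Edge permutations of the complete graph *)

Section EdgePermutations.
Variable m : nat.
Local Notation P := ('I_m * 'I_m)%type.

Definition flip (x : P) : P := (x.2, x.1).

Definition offdiag (x : P) := x.1 != x.2.

Definition ends (x : P) : {set 'I_m} := [set x.1; x.2]%SET.

(** Acting on all ordered pairs makes s a permutation of the entries of a Gram
    matrix; commuting with [flip] keeps that matrix symmetric and [offdiag]
    keeps the squared norms on the diagonal. *)
Definition edge_perm (s : {perm P}) :=
  forall x, s (flip x) = flip (s x) /\ offdiag (s x) = offdiag x.

Lemma ends_flip x : ends (flip x) = ends x.
Proof. by rewrite /ends finset.setUC. Qed.

Lemma endsP x b : b \in ends x -> exists a, x = (b, a) \/ x = (a, b).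
Proof.
by case: x => p q; rewrite !inE /= => /orP[]/eqP->; [exists q; left|exists p; right].
Qed.

Lemma eq_ends x y : offdiag x -> offdiag y -> ends x = ends y -> x = y \/ x = flip y.
Proof.
case: x y => [a b] [c d]; rewrite /offdiag /ends /flip /= => ab cd e.
move: (set21 a b) (set22 a b) (set21 c d) (set22 c d); rewrite e -{3 4}e !inE.
move=> /orP[]/eqP ac /orP[]/eqP bd /orP[]/eqP ca /orP[]/eqP db;
  subst; rewrite ?eqxx // in ab cd *; auto.
Qed.

Lemma edge_perm_ends s x y : edge_perm s -> offdiag x -> offdiag y ->
  ends (s x) = ends (s y) -> x = y \/ x = flip y.
Proof.
move=> es ox oy /eq_ends []; rewrite ?(es _).2 //; first by move/perm_inj; left.
by rewrite -(es _).1 => /perm_inj; right.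
Qed.

(** An injective self-map of a finite set is onto: the pairs of disjoint edges
    are permuted by s, hence so are the pairs of edges that meet. *)
Lemma edge_perm_meet (s : {perm P}) : edge_perm s ->
    (forall x y, offdiag x -> offdiag y -> [disjoint ends x & ends y] ->
       [disjoint ends (s x) & ends (s y)]) ->
  forall x y, offdiag x -> offdiag y -> [disjoint ends (s x) & ends (s y)] ->
    [disjoint ends x & ends y].
Proof.
move=> es sdisj x y ox oy dsxy.
pose X := [set z : P * P | [&& offdiag z.1, offdiag z.2 &
                            [disjoint ends z.1 & ends z.2]]]%SET.
pose phi (z : P * P) := (s z.1, s z.2).
have phiI : injective phi by move=> [a b] [c d] [/perm_inj-> /perm_inj->].
have phiX : phi @: X = X.
  apply/eqP; rewrite eqEcard card_imset // leqnn andbT.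
  apply/fintype.subsetP => _ /imsetP[z + ->]; rewrite !inE => /and3P[ox1 ox2 dz].
  by rewrite !(es _).2 ox1 ox2 sdisj.
have : phi (x, y) \in X by rewrite inE /= !(es _).2 ox oy.
by rewrite -{1}phiX mem_imset // inE => /and3P[].
Qed.

Definition triangle (x y z : P) := exists p q r, [/\ uniq [:: p; q; r],
  ends x = [set p; q]%SET, ends y = [set p; r]%SET & ends z = [set q; r]%SET].

Lemma ends_other x b : offdiag x -> b \in ends x ->
  exists2 a, a != b & ends x = [set b; a]%SET.
Proof.
move=> ox /endsP[a [] e]; subst x; exists a; rewrite /ends //= 1?finset.setUC //.
by rewrite eq_sym.
Qed.

Lemma triangle_of_meeting x y z :
    offdiag x -> offdiag y -> offdiag z -> ends x != ends y ->
    ~~ [disjoint ends x & ends y] -> ~~ [disjoint ends x & ends z] ->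
    ~~ [disjoint ends y & ends z] ->
    (forall b, b \in ends x -> b \in ends y -> b \in ends z -> False) ->
  triangle x y z.
Proof.
move=> ox oy oz exy mxy mxz myz nb.
have meet (A B : {set 'I_m}) : ~~ [disjoint A & B] -> exists2 b, b \in A & b \in B.
  by rewrite -finset.setI_eq0 => /finset.set0Pn[b]; rewrite inE => /andP[]; exists b.
have [p px py] := meet _ _ mxy.
have [q qp xE] := ends_other ox px; have [r rp yE] := ends_other oy py.
have pz : p \notin ends z by apply/negP => /nb; apply.
have qz : q \in ends z.
  have [b] := meet _ _ mxz; rewrite xE in_set2 => /orP[]/eqP-> //.
  by rewrite (negPf pz).
have rz : r \in ends z.
  have [b] := meet _ _ myz; rewrite yE in_set2 => /orP[]/eqP-> //.
  by rewrite (negPf pz).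
have qr : q != r by apply: contra exy => /eqP qr; rewrite xE yE qr.
exists p, q, r; split=> //.
  by rewrite /= !inE negb_or ![p == _]eq_sym qp rp qr.
have [t tq zE] := ends_other oz qz; rewrite zE.
by move: rz; rewrite zE !inE eq_sym (negPf qr) /= => /eqP->.
Qed.

Lemma exists_third (i j : 'I_m) : (2 < m)%N -> exists k, (k != i) && (k != j).
Proof.
move=> m2; have : (0 < #|~: [set i; j]|)%N.
  rewrite cardsCs finset.setCK card_ord subn_gt0; apply: leq_ltn_trans m2.
  by rewrite cards2; case: (_ != _).
by case/card_gt0P => k; rewrite !inE negb_or; exists k.
Qed.

(** The images pq and pr of two edges ij and ik meet, and jk is sent to qr. The
    image of any other edge at i meets both pq and pr; if it avoided p it would
    be qr, against injectivity. So the images of all edges at i have a common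
    vertex p, which is the image of i. *)
Lemma edge_perm_induced (s : {perm P}) : (2 < m)%N -> edge_perm s ->
    (forall i j k, uniq [:: i; j; k] -> triangle (s (i, j)) (s (i, k)) (s (j, k))) ->
  exists rho : 'I_m -> 'I_m, injective rho /\
    forall i j, i != j -> ends (s (i, j)) = [set rho i; rho j]%SET.
Proof.
move=> m2 es tri.
have apex i : exists p, forall j, j != i -> p \in ends (s (i, j)).
  have [j /andP[ji _]] := exists_third i i m2; have [k /andP[ki kj]] := exists_third i j m2.
  have [|p [q [r [upqr xE yE zE]]]] := tri i j k.
    by rewrite /= !inE negb_or !(eq_sym i) ji ki eq_sym kj.
  exists p => l li.
  have [->|lj] := eqVneq l j; first by rewrite xE !inE eqxx.
  have [->|lk] := eqVneq l k; first by rewrite yE !inE eqxx.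
  have [|p1 [q1 [r1 [u1 x1 y1 _]]]] := tri i j l.
    by rewrite /= !inE negb_or !(eq_sym i) ji li eq_sym lj.
  have [|p2 [q2 [r2 [u2 x2 y2 _]]]] := tri i k l.
    by rewrite /= !inE negb_or !(eq_sym i) ki li eq_sym lk.
  (* If p is not an end of s (i, l), then s (i, l) = {q, r} = s (j, k). *)
  apply/negPn/negP => pl.
  have p1l : p1 \in ends (s (i, l)) by rewrite y1 !inE eqxx.
  have p2l : p2 \in ends (s (i, l)) by rewrite y2 !inE eqxx.
  have p1q : p1 = q.
    have : p1 \in ends (s (i, j)) by rewrite x1 !inE eqxx.
    by rewrite xE !inE => /orP[]/eqP e //; rewrite -e p1l in pl.
  have p2r : p2 = r.
    have : p2 \in ends (s (i, k)) by rewrite x2 !inE eqxx.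
    by rewrite yE !inE => /orP[]/eqP e //; rewrite -e p2l in pl.
  move: upqr; rewrite /= !inE negb_or andbT => /andP[_ qr].
  have oil : offdiag (i, l) by rewrite /offdiag eq_sym.
  have ojk : offdiag (j, k) by rewrite /offdiag eq_sym.
  have : ends (s (i, l)) = ends (s (j, k)).
    have [||t tq lE] := @ends_other (s (i, l)) q; rewrite ?(es _).2 //.
      by rewrite -p1q.
    move: p2l; rewrite lE zE p2r !inE => /orP[/eqP rq|/eqP->//].
    by rewrite rq eqxx in qr.
  case/(edge_perm_ends es oil ojk) => -[ij lk'].
    by rewrite lk' eqxx in lk.
  by rewrite lk' eqxx in lj.
have [rho rhoP] := boolp.choice apex.
have endsC i j : ends (s (j, i)) = ends (s (i, j)).
  by rewrite -[(j, i)]/(flip (i, j)) (es _).1 ends_flip.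
have rhoI i j : i != j -> rho i != rho j.
  move=> ij; have [k /andP[ki kj]] := exists_third i j m2.
  have [|p [q [r [upqr xE yE zE]]]] := tri i j k.
    by rewrite /= !inE negb_or ij !(eq_sym _ k) ki kj.
  have ji : j != i by rewrite eq_sym.
  move: upqr; rewrite /= !inE negb_or andbT => /andP[/andP[pq pr] qr].
  have := rhoP i j ji; have := rhoP i k ki.
  have := rhoP j i ij; have := rhoP j k kj.
  rewrite (endsC i j) xE yE zE !inE => /orP[]/eqP-> /orP[]/eqP e1 /orP[]/eqP e2 /orP[]/eqP e3;
    subst; rewrite ?eqxx // in pq pr qr *; by rewrite ?e2 ?e3 // eq_sym.
exists rho; split=> [i j e|i j ij].
  by apply/eqP/negPn/negP => /rhoI; rewrite e eqxx.
have ji : j != i by rewrite eq_sym.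
have [||t tr E] := @ends_other (s (i, j)) (rho i); rewrite ?(es _).2 ?rhoP //.
have := rhoP j i ij; rewrite endsC E in_set2.
by rewrite eq_sym (negPf (rhoI _ _ ij)) /= => /eqP->.
Qed.
End EdgePermutations.

(** * Star-shaped Gram matrices and singular minors *)

(** The points of B receive an orthonormal basis and b the vector with
    coordinates x in that basis. The points outside B and b repeat the
    basis vector of some b0 in B, so that all vectors have length 1. *)
Lemma star_conf_aux (R : rcfType) (m : nat) (B : {set 'I_m}) (b : 'I_m)
    (x : 'I_m -> R) : (0 < #|B|)%N -> b \notin B ->
    \sum_(q in B) x q * x q = 1 ->
  exists v : 'M[R]_(#|B|, m), [/\ unit_conf v,
    forall q, q \in B -> (v^T *m v) b q = x q,
    forall q, q \in B -> (v^T *m v) q b = x q &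
    forall p q, p \in B -> q \in B -> p != q -> (v^T *m v) p q = 0].
Proof.
move=> B0 bB x1; have [b0 b0B] := card_gt0P B0.
pose v : 'M[R]_(#|B|, m) := \matrix_(k, q) if q == b then x (enum_val k)
  else (enum_val k == (if q \in B then q else b0))%:R.
have bn q : q \in B -> (q == b) = false.
  by move=> qB; apply: contraNF bB => /eqP<-.
have vE q k : q \in B -> v k q = (enum_val k == q)%:R.
  by move=> qB; rewrite mxE bn // qB.
have sumB (F : 'I_m -> R) q : q \in B ->
    \sum_(k < #|B|) F (enum_val k) * (enum_val k == q)%:R = F q.
  move=> qB; rewrite -(big_enum_val (fun p => F p * (p == q)%:R)) (bigD1 q) //= eqxx mulr1.
  by rewrite big1 ?addr0 // => p /andP[_ /negPf->]; rewrite mulr0.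
have vb k : v k b = x (enum_val k) by rewrite mxE eqxx.
exists v; split.
- move=> q; rewrite gramE; have [->|qb] := eqVneq q b.
    under eq_bigr do rewrite vb.
    by rewrite -(big_enum_val (fun p => x p * x p)).
  pose q' := if q \in B then q else b0.
  have q'B : q' \in B by rewrite /q'; case: ifP.
  have := sumB (fun p => (p == q')%:R) q' q'B; rewrite /= eqxx => e; rewrite -[RHS]/(true%:R) -e.
  by apply: eq_bigr => k _; rewrite mxE (negPf qb).
- move=> q qB; rewrite gramE -[RHS]sumB //.
  by apply: eq_bigr => k _; rewrite vb vE.
- move=> q qB; rewrite gramE -[RHS]sumB //.
  by apply: eq_bigr => k _; rewrite vb vE // mulrC.
move=> p q pB qB pq; rewrite gramE.
rewrite -[RHS](_ : (q == p)%:R = 0); last by rewrite eq_sym (negPf pq).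
rewrite -[RHS](sumB (fun r => (r == p)%:R)) //.
by apply: eq_bigr => k _; rewrite !vE.
Qed.

(** On a set W of n + 1 points the Gram matrix can be the identity plus any
    weights of square sum 1 on the edges of the star centred at b. *)
Lemma star_conf (R : rcfType) (n m : nat) (W : {set 'I_m}) (b : 'I_m)
    (x : 'I_m -> R) : (0 < n)%N -> #|W| = n.+1 -> b \in W ->
    \sum_(q in W :\ b) x q * x q = 1 ->
  exists2 v : 'M[R]_(n, m), unit_conf v &
    forall z, z.1 \in W -> z.2 \in W -> offdiag z ->
      (forall q, ends z = [set b; q]%SET -> (v^T *m v) z.1 z.2 = x q) /\
      (b \notin ends z -> (v^T *m v) z.1 z.2 = 0).
Proof.
move=> n0 cW bW; have : #|W :\ b| = n by move: cW; rewrite (cardsD1 b) bW => -[].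
move=> cB; move: n0; rewrite -cB => n0 x1 {cW cB n}.
have bB : b \notin (W :\ b)%SET by rewrite !inE eqxx.
have [v [v1 vb bv v0]] := star_conf_aux n0 bB x1.
exists v => // -[p q] /= pW qW; rewrite /offdiag /= => pq; split; last first.
  rewrite /ends !inE negb_or /= => /andP[bp bq].
  by rewrite v0 // !inE ?pW ?qW ?[_ == b]eq_sym ?bp ?bq.
move=> t E; have : b \in ends (p, q) by rewrite E !inE eqxx.
rewrite in_set2 /= => /orP[]/eqP eb; subst b.
  have : q \in ends (p, q) by rewrite !inE eqxx orbT.
  rewrite E !inE => /orP[/eqP e|/eqP e]; first by rewrite e eqxx in pq.
  by subst t; apply: vb; rewrite !inE qW eq_sym pq.
have : p \in ends (p, q) by rewrite !inE eqxx.
rewrite E !inE => /orP[/eqP e|/eqP e]; first by rewrite e eqxx in pq.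
by subst t; apply: bv; rewrite !inE pW pq.
Qed.

(** A principal minor vanishes, expressed by a linear relation between the rows
    so that W need not be enumerated. *)
Definition singular_on (R : pzRingType) (m : nat) (W : {set 'I_m})
    (M : 'I_m * 'I_m -> R) :=
  exists y, (exists2 i, i \in W & y i != 0) /\
    forall j, j \in W -> \sum_(i in W) y i * M (i, j) = 0.

Lemma card_extend (m k : nat) (S : {set 'I_m}) : (#|S| <= k <= m)%N ->
  exists2 W : {set 'I_m}, S \subset W & #|W| = k.
Proof.
case/andP; elim: k => [|k IH] Sk km.
  by exists S => //; apply/eqP; rewrite -leqn0.
move: Sk; rewrite leq_eqVlt => /orP[/eqP Sk|Sk]; first by exists S.
have [W SW cW] := IH Sk (ltnW km).
have : (0 < #|~: W|)%N by rewrite cardsCs finset.setCK card_ord cW subn_gt0.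
case/card_gt0P => w; rewrite inE => wW; exists (w |: W)%SET.
  by apply: fintype.subset_trans SW _; apply: finset.subsetUr.
by rewrite cardsU1 wW cW.
Qed.

(** In this section s is an edge permutation for which every principal
    (n+1)-minor of the permuted Gram matrix vanishes identically on unit
    configurations. *)
Section Rigidity.
Variables (R : rcfType) (n m : nat) (s : {perm 'I_m * 'I_m}).
Hypotheses (n_gt1 : (1 < n)%N) (ltnm : (n < m)%N) (es : edge_perm s).
Hypothesis singular : forall (W : {set 'I_m}) (v : 'M[R]_(n, m)),
  #|W| = n.+1 -> unit_conf v ->
  singular_on W (fun z => (v^T *m v) (s z).1 (s z).2).

Lemma offdiag_pair (W : {set 'I_m}) (v : 'M[R]_(n, m)) (y : 'I_m -> R) j :
    unit_conf v -> j \in W ->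
  \sum_(i in W) y i * (v^T *m v) (s (i, j)).1 (s (i, j)).2 =
  y j + \sum_(i in W | i != j) y i * (v^T *m v) (s (i, j)).1 (s (i, j)).2.
Proof.
move=> v1 jW; rewrite (bigD1 j) //=; congr (_ + _).
have : ~~ offdiag (s (j, j)) by rewrite (es _).2 /offdiag eqxx.
by rewrite negbK => /eqP->; rewrite v1 mulr1.
Qed.

(** Otherwise the image of the clique on W is a graph with orthogonal
    representation, which turns the permuted Gram matrix on W into the
    identity. *)
Lemma clique_to_clique (W : {set 'I_m}) : #|W| = n.+1 ->
  exists2 W' : {set 'I_m}, #|W'| = n.+1 &
    forall i j, i \in W -> j \in W -> i != j ->
      ((s (i, j)).1 \in W') && ((s (i, j)).2 \in W').
Proof.
move=> cW; pose X := [set z : 'I_m * 'I_m | [&& z.1 \in W, z.2 \in W & offdiag z]]%SET.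
pose r p q := (p, q) \in s @: X.
have rE z : r (s z).1 (s z).2 = (z \in X).
  by rewrite /r -surjective_pairing mem_imset //; exact: perm_inj.
have rI : irreflexive r.
  move=> p; apply/negP => /imsetP[z]; rewrite inE => /and3P[_ _ oz] e.
  by move: oz; rewrite -(es _).2 -e /offdiag eqxx.
have rC : symmetric r.
  suff H p q : r p q -> r q p by move=> p q; apply/idP/idP; apply: H.
  case/imsetP => z; rewrite inE => /and3P[z1 z2 oz] e.
  rewrite /r; have -> : (q, p) = s (flip z) by rewrite (es _).1 -e.
  rewrite mem_imset; last exact: perm_inj.
  by rewrite inE /= z1 z2 /offdiag eq_sym.
(* An (n+1)-clique has (n + 1)^2 - (n + 1) oriented edges. *)
have cX : (#|[set z : 'I_m * 'I_m | r z.1 z.2]| <= n.+1 * n)%N.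
  have -> : [set z : 'I_m * 'I_m | r z.1 z.2]%SET = s @: X.
    by apply/setP => -[p q]; rewrite inE.
  rewrite card_imset; last exact: perm_inj.
  pose D := [set (i, i) | i in W]%SET.
  have cD : #|D| = n.+1 by rewrite card_imset ?cW // => i j [].
  have DX : [disjoint X & D].
    apply/pred0P => z /=; apply/negbTE/negP => /andP[+ /imsetP[i _ zi]].
    by rewrite zi inE /offdiag eqxx /= !andbF.
  rewrite -(leq_add2r #|D|) [X in (_ <= _ + X)%N]cD -mulnSr -cW -cardsX.
  rewrite (leq_trans _ (subset_leq_card (_ : X :|: D \subset _))) //.
    by rewrite cardsU; move: DX; rewrite -finset.setI_eq0 => /eqP->; rewrite cards0 subn0.
  apply/fintype.subsetP => z; rewrite !inE => /orP[/and3P[-> ->]//|/imsetP[i iW ->]].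
  by rewrite /= iW.
have [[A cA rA]|degen] := sparse_graph_degenerate (ltnW n_gt1) rI cX.
  exists A => // i j iW jW ij; apply: rA; rewrite rE.
  by rewrite inE iW jW /offdiag /= ij.
have [v v1 v0] := orthogonal_representation R rC degen.
have [y [[i iW yi]]] := singular cW v1.
move/(_ i iW); rewrite (offdiag_pair _ v1 iW) big1 ?addr0 => [y0|j /andP[jW ji]].
  by rewrite y0 eqxx in yi.
rewrite v0 ?mulr0 // ?rE ?inE /offdiag /= ?iW ?jW ?ji //.
by rewrite -[_ != _]/(offdiag _) (es _).2.
Qed.

(** Here M is the pullback by s of the star-shaped Gram matrix on W', so that it
    is supported on the edges of W that s sends to the star at b; y is a
    relation between its rows. *)
Lemma star_relation (W W' : {set 'I_m}) (b : 'I_m) (x : 'I_m -> R) :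
    #|W| = n.+1 -> #|W'| = n.+1 -> b \in W' ->
    (forall i j, i \in W -> j \in W -> i != j ->
      ((s (i, j)).1 \in W') && ((s (i, j)).2 \in W')) ->
    \sum_(q in W' :\ b) x q * x q = 1 ->
  exists (y : 'I_m -> R) (M : 'I_m * 'I_m -> R),
    [/\ exists2 i, i \in W & y i != 0,
        forall j, j \in W -> y j + \sum_(i in W | i != j) y i * M (i, j) = 0,
        forall z q, z.1 \in W -> z.2 \in W -> offdiag z ->
          ends (s z) = [set b; q]%SET -> M z = x q &
        forall z, z.1 \in W -> z.2 \in W -> offdiag z -> b \notin ends (s z) ->
          M z = 0].
Proof.
move=> cW cW' bW' WW' x1.
have [v v1 vM] := star_conf (ltnW n_gt1) cW' bW' x1.
have [y [yn0 y0]] := singular cW v1.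
have sW z : z.1 \in W -> z.2 \in W -> offdiag z ->
    ((s z).1 \in W') && ((s z).2 \in W').
  by move: z => [i j] /= iW jW oz; apply: WW'.
exists y, (fun z => (v^T *m v) (s z).1 (s z).2); split=> //.
- by move=> j jW; rewrite -offdiag_pair // y0.
- move=> z q z1 z2 oz; have /andP[sz1 sz2] := sW z z1 z2 oz.
  by rewrite -(es z).2 in oz; have [H _] := vM (s z) sz1 sz2 oz; apply: H.
- move=> z z1 z2 oz; have /andP[sz1 sz2] := sW z z1 z2 oz.
  by rewrite -(es z).2 in oz; have [_ H] := vM (s z) sz1 sz2 oz; apply: H.
Qed.

Lemma ends_sub_clique (W W' : {set 'I_m}) z :
    (forall i j, i \in W -> j \in W -> i != j ->
      ((s (i, j)).1 \in W') && ((s (i, j)).2 \in W')) ->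
  offdiag z -> z.1 \in W -> z.2 \in W -> ends (s z) \subset W'.
Proof.
move=> WW'; case: z => i j oz iW jW; have /andP[h1 h2] := WW' i j iW jW oz.
by apply/fintype.subsetP => q; rewrite !inE => /orP[]/eqP->.
Qed.

Lemma sum_two_terms (W : {set 'I_m}) (y M : 'I_m -> R) t t' :
    t' \in W -> t' != t ->
    (forall i, i \in W -> i != t -> i != t' -> M i = 0) ->
  \sum_(i in W | i != t) y i * M i = y t' * M t'.
Proof.
move=> t'W tt' M0; rewrite (bigD1 t') ?t'W //= big1 ?addr0 //.
by move=> i /andP[/andP[iW it] it']; rewrite M0 ?mulr0.
Qed.

Lemma sum_three_terms (W : {set 'I_m}) (y M : 'I_m -> R) t t1 t2 :
    t1 \in W -> t2 \in W -> uniq [:: t; t1; t2] ->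
    (forall i, i \in W -> i != t -> i != t1 -> i != t2 -> M i = 0) ->
  \sum_(i in W | i != t) y i * M i = y t1 * M t1 + y t2 * M t2.
Proof.
move=> t1W t2W; rewrite /= !inE negb_or andbT => /andP[/andP[tt1 tt2] t12] M0.
rewrite (bigD1 t1) ?t1W 1?eq_sym //=; congr (_ + _).
rewrite (bigD1 t2) ?t2W 1?eq_sym ?tt2 //=; last by rewrite eq_sym.
rewrite big1 ?addr0 //.
by move=> i /andP[/andP[/andP[iW it] it1] it2]; rewrite M0 ?mulr0.
Qed.

(** Suppose that s sends disjoint edges ij and kl to adjacent edges ba and bc.
    For the star with weights 3/5 and 4/5 on them, the pullback is a sum of two
    invertible 2 x 2 blocks and an identity matrix. The hypothesis on n gives
    room for the four end points in a set of n + 1 points. *)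
Lemma disjoint_to_disjoint x y : (2 < n)%N -> offdiag x -> offdiag y ->
  [disjoint ends x & ends y] -> [disjoint ends (s x) & ends (s y)].
Proof.
move=> n2; case: x y => [i j] [k l] ox oy dxy.
rewrite -finset.setI_eq0; apply/negPn/negP => /finset.set0Pn[b].
rewrite finset.in_setI => /andP[bx by_].
have ne t u : t \in ends (i, j) -> u \in ends (k, l) -> t != u.
  move=> tx uy; apply/negP => /eqP tu.
  by move/pred0P/(_ t): dxy; rewrite /= tx tu uy.
have ik : i != k by rewrite ne ?inE ?eqxx ?orbT.
have il : i != l by rewrite ne ?inE ?eqxx ?orbT.
have jk : j != k by rewrite ne ?inE ?eqxx ?orbT.
have jl : j != l by rewrite ne ?inE ?eqxx ?orbT.
have ij : i != j by []. have kl : k != l by [].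
have ck : (#|[set i; j] :|: [set k; l]| <= n.+1 <= m)%N.
  by rewrite ltnm andbT (leq_trans (leq_card_setU _ _)) // !cards2 ij kl.
have [W] := card_extend ck.
rewrite finset.subUset !finset.subUset !finset.sub1set => /andP[/andP[iW jW] /andP[kW lW]] cW.
have [W' cW' WW'] := clique_to_clique cW.
have xW' := ends_sub_clique WW' ox iW jW; have yW' := ends_sub_clique WW' oy kW lW.
have bW' : b \in W' by apply: (fintype.subsetP xW').
have [||a ab xE] := @ends_other m (s (i, j)) b; rewrite ?(es _).2 //.
have [||c cb yE] := @ends_other m (s (k, l)) b; rewrite ?(es _).2 //.
have aW' : a \in W' by apply: (fintype.subsetP xW'); rewrite xE !inE eqxx orbT.
have cW'' : c \in W' by apply: (fintype.subsetP yW'); rewrite yE !inE eqxx orbT.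
have ac : a != c.
  apply/negP => /eqP ac; have : ends (s (i, j)) = ends (s (k, l)) by rewrite xE yE ac.
  case/(edge_perm_ends es ox oy) => -[ei ej]; first by rewrite ei eqxx in ik.
  by rewrite ei eqxx in il.
(* The Pythagorean triple 3, 4, 5 makes the square sum equal to 1. *)
pose wt q : R := if q == a then 3 / 5 else if q == c then 4 / 5 else 0.
have wta : wt a = 3 / 5 by rewrite /wt eqxx.
have wtc : wt c = 4 / 5 by rewrite /wt eq_sym (negPf ac) eqxx.
have wt1 : \sum_(q in W' :\ b) wt q * wt q = 1.
  rewrite (bigD1 a) ?inE ?ab ?aW' //= (bigD1 c) ?inE ?cb ?cW'' ?(eq_sym c) //=.
  rewrite big1 => [|q /andP[/andP[_ qa] qc]]; first by rewrite wta wtc; field.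
  by rewrite /wt (negPf qa) (negPf qc) mul0r.
have [y [M [[t tW yt] y0 Mq M0]]] := star_relation cW cW' bW' WW' wt1.
have Msupp t1 t2 : t1 \in W -> t2 \in W -> t1 != t2 ->
    [&& (t1, t2) != (i, j), (t1, t2) != (j, i), (t1, t2) != (k, l) & (t1, t2) != (l, k)] ->
    M (t1, t2) = 0.
  move=> t1W t2W t12 /and4P[nij nji nkl nlk].
  have ot : offdiag (t1, t2) by [].
  have [bz|] := boolP (b \in ends (s (t1, t2))); last exact: M0.
  have [||q qb zE] := @ends_other m (s (t1, t2)) b; rewrite ?(es _).2 //.
  rewrite (Mq _ q) // /wt; case: eqP => [qa|_].
    have : ends (s (t1, t2)) = ends (s (i, j)) by rewrite zE xE qa.
    by case/(edge_perm_ends es ot ox) => e; rewrite e eqxx in nij nji.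
  case: eqP => [qc|//].
  have : ends (s (t1, t2)) = ends (s (k, l)) by rewrite zE yE qc.
  by case/(edge_perm_ends es ot oy) => e; rewrite e eqxx in nkl nlk.
have MC t1 t2 q : t1 \in W -> t2 \in W -> t1 != t2 -> ends (s (t1, t2)) = [set b; q]%SET ->
    M (t1, t2) = wt q /\ M (t2, t1) = wt q.
  move=> t1W t2W t12 E; split; apply: Mq => //; first by rewrite /offdiag eq_sym.
  by rewrite -[(t2, t1)]/(flip (t1, t2)) (es _).1 ends_flip.
have [Mij Mji] := MC i j a iW jW ij xE; have [Mkl Mlk] := MC k l c kW lW kl yE.
have two t1 t2 : t1 \in W -> t2 \in W -> t2 != t1 ->
    (forall u, u \in W -> u != t1 -> u != t2 -> M (u, t1) = 0) ->
    y t1 + y t2 * M (t2, t1) = 0.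
  by move=> t1W t2W t21 H; rewrite -(y0 t1) // (sum_two_terms y (M := fun u => M (u, t1)) t2W).
have e1 : y i + y j * M (j, i) = 0.
  apply: two => //; first by rewrite eq_sym.
  move=> u uW ui uj; apply: Msupp => //; rewrite !xpair_eqE !negb_and.
  by rewrite ui uj ij ik il ?orbT.
have e2 : y j + y i * M (i, j) = 0.
  apply: two => // u uW ui uj; apply: Msupp => //; rewrite !xpair_eqE !negb_and.
  by rewrite ui uj jk jl ?orbT.
have e3 : y k + y l * M (l, k) = 0.
  apply: two => //; first by rewrite eq_sym.
  move=> u uW uk ul; apply: Msupp => //; rewrite !xpair_eqE !negb_and.
  by rewrite uk ul kl !(eq_sym k) ik jk ?orbT.
have e4 : y l + y k * M (k, l) = 0.
  apply: two => // u uW uk ul; apply: Msupp => //; rewrite !xpair_eqE !negb_and.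
  by rewrite uk ul !(eq_sym l) il jl ?orbT.
rewrite Mij Mji Mkl Mlk wta wtc in e1 e2 e3 e4.
have yi : y i = 0 by lra. have yj : y j = 0 by lra.
have yk : y k = 0 by lra. have yl : y l = 0 by lra.
have [ti|ti] := eqVneq t i; first by rewrite ti yi eqxx in yt.
have [tj|tj] := eqVneq t j; first by rewrite tj yj eqxx in yt.
have [tk|tk] := eqVneq t k; first by rewrite tk yk eqxx in yt.
have [tl|tl] := eqVneq t l; first by rewrite tl yl eqxx in yt.
have := y0 t tW; rewrite big1 ?addr0 => [e|u /andP[uW ut]]; first by rewrite e eqxx in yt.
rewrite Msupp ?mulr0 // !xpair_eqE !negb_and.
by rewrite ti tj tk tl !orbT.
Qed.

(** Suppose that s sends the triangle ijk to three edges at b. For the star with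
    weights x = y = 2/3 and z = 1/3 on them, the pullback is an identity matrix
    and a 3 x 3 block of determinant 2 x y z. *)
Lemma no_star (i j k b : 'I_m) : uniq [:: i; j; k] ->
  b \in ends (s (i, j)) -> b \in ends (s (i, k)) -> b \in ends (s (j, k)) -> False.
Proof.
move=> + b1 b2 b3; rewrite /= !inE negb_or andbT => /andP[/andP[ij ik] jk].
have oij : offdiag (i, j) by []. have oik : offdiag (i, k) by [].
have ojk : offdiag (j, k) by [].
have ck : (#|i |: [set j; k]| <= n.+1 <= m)%N.
  by rewrite ltnm andbT cardsU1 cards2 jk !inE negb_or ij ik.
have [W] := card_extend ck.
rewrite !finset.subUset !finset.sub1set => /and3P[iW jW kW] cW.
have [W' cW' WW'] := clique_to_clique cW.
have W1 := ends_sub_clique WW' oij iW jW; have W2 := ends_sub_clique WW' oik iW kW.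
have W3 := ends_sub_clique WW' ojk jW kW.
have bW' : b \in W' by apply: (fintype.subsetP W1).
have [||a ab E1] := @ends_other m (s (i, j)) b; rewrite ?(es _).2 //.
have [||c cb E2] := @ends_other m (s (i, k)) b; rewrite ?(es _).2 //.
have [||d db E3] := @ends_other m (s (j, k)) b; rewrite ?(es _).2 //.
have aW' : a \in W' by apply: (fintype.subsetP W1); rewrite E1 !inE eqxx orbT.
have cW'' : c \in W' by apply: (fintype.subsetP W2); rewrite E2 !inE eqxx orbT.
have dW' : d \in W' by apply: (fintype.subsetP W3); rewrite E3 !inE eqxx orbT.
have ac : a != c.
  apply/negP => /eqP e; have : ends (s (i, j)) = ends (s (i, k)) by rewrite E1 E2 e.
  case/(edge_perm_ends es oij oik) => [[ei]|[ei _]]; first by rewrite ei eqxx in jk.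
  by rewrite ei eqxx in ik.
have ad : a != d.
  apply/negP => /eqP e; have : ends (s (i, j)) = ends (s (j, k)) by rewrite E1 E3 e.
  case/(edge_perm_ends es oij ojk) => [[ei _]|[ei]]; first by rewrite ei eqxx in ij.
  by rewrite ei eqxx in ik.
have cd : c != d.
  apply/negP => /eqP e; have : ends (s (i, k)) = ends (s (j, k)) by rewrite E2 E3 e.
  case/(edge_perm_ends es oik ojk) => [[ei]|[ei _]]; first by rewrite ei eqxx in ij.
  by rewrite ei eqxx in ik.
(* 2^2 + 2^2 + 1^2 = 3^2, and none of the three weights is zero. *)
pose wt q : R := if q == a then 2 / 3 else if q == c then 2 / 3 else
  if q == d then 1 / 3 else 0.
have wta : wt a = 2 / 3 by rewrite /wt eqxx.
have wtc : wt c = 2 / 3 by rewrite /wt eq_sym (negPf ac) eqxx.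
have wtd : wt d = 1 / 3 by rewrite /wt eq_sym (negPf ad) eq_sym (negPf cd) eqxx.
have wt1 : \sum_(q in W' :\ b) wt q * wt q = 1.
  rewrite (bigD1 a) ?inE ?ab ?aW' //= (bigD1 c) ?inE ?cb ?cW'' ?(eq_sym c) //=.
  rewrite (bigD1 d) ?inE ?db ?dW' ?(eq_sym d) ?ad ?cd //=.
  rewrite big1 => [|q /andP[/andP[/andP[_ qa] qc] qd]].
    by rewrite wta wtc wtd; field.
  by rewrite /wt (negPf qa) (negPf qc) (negPf qd) mul0r.
have [y [M [[t tW yt] y0 Mq M0]]] := star_relation cW cW' bW' WW' wt1.
have Msupp t1 t2 : t1 \in W -> t2 \in W -> t1 != t2 ->
    (t1 \notin [set i; j; k]%SET) || (t2 \notin [set i; j; k]%SET) -> M (t1, t2) = 0.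
  move=> t1W t2W t12 nt.
  have ot : offdiag (t1, t2) by [].
  have [bz|] := boolP (b \in ends (s (t1, t2))); last exact: M0.
  have [||q qb zE] := @ends_other m (s (t1, t2)) b; rewrite ?(es _).2 //.
  have nE z : z.1 \in [set i; j; k]%SET -> z.2 \in [set i; j; k]%SET -> offdiag z ->
      ends (s (t1, t2)) <> ends (s z).
    case: z => z1 z2 /= h1 h2 oz /(edge_perm_ends es ot oz) [] [e1 e2];
    by rewrite e1 e2 h1 h2 in nt.
  rewrite (Mq _ q) // /wt; case: eqP => [e|_].
    by case: (nE (i, j)); rewrite ?inE ?eqxx ?orbT ?zE ?E1 ?e.
  case: eqP => [e|_]; first by case: (nE (i, k)); rewrite ?inE ?eqxx ?orbT ?zE ?E2 ?e.
  by case: eqP => [e|//]; case: (nE (j, k)); rewrite ?inE ?eqxx ?orbT ?zE ?E3 ?e.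
have MC t1 t2 q : t1 \in W -> t2 \in W -> t1 != t2 -> ends (s (t1, t2)) = [set b; q]%SET ->
    M (t1, t2) = wt q /\ M (t2, t1) = wt q.
  move=> t1W t2W t12 E; split; apply: Mq => //; first by rewrite /offdiag eq_sym.
  by rewrite -[(t2, t1)]/(flip (t1, t2)) (es _).1 ends_flip.
have [Mij Mji] := MC i j a iW jW ij E1; have [Mik Mki] := MC i k c iW kW ik E2.
have [Mjk Mkj] := MC j k d jW kW jk E3.
have three t1 t2 t3 : t1 \in W -> t2 \in W -> t3 \in W -> uniq [:: t1; t2; t3] ->
    [set i; j; k]%SET = [set t1; t2; t3]%SET ->
    y t1 + (y t2 * M (t2, t1) + y t3 * M (t3, t1)) = 0.
  move=> t1W t2W t3W u E; rewrite -(y0 t1) //.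
  rewrite (sum_three_terms y (M := fun u => M (u, t1)) t2W t3W) // => v vW v1 v2 v3.
  by rewrite Msupp // E !inE (negPf v1) (negPf v2) (negPf v3).
have e1 : y i + (y j * M (j, i) + y k * M (k, i)) = 0.
  by apply: three; rewrite //= !inE negb_or ij ik jk.
have e2 : y j + (y i * M (i, j) + y k * M (k, j)) = 0.
  apply: three; rewrite //= ?inE ?negb_or 1?eq_sym ?ij ?ik ?jk //.
  by apply/setP => u; rewrite !inE; do ![case: eqP].
have e3 : y k + (y i * M (i, k) + y j * M (j, k)) = 0.
  apply: three; rewrite //= ?inE ?negb_or 1?eq_sym ?ij ?ik 1?eq_sym ?jk //.
  by apply/setP => u; rewrite !inE; do ![case: eqP].
rewrite Mij Mji Mik Mki Mjk Mkj wta wtc wtd in e1 e2 e3.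
have yi : y i = 0 by lra. have yj : y j = 0 by lra. have yk : y k = 0 by lra.
have [ti|ti] := eqVneq t i; first by rewrite ti yi eqxx in yt.
have [tj|tj] := eqVneq t j; first by rewrite tj yj eqxx in yt.
have [tk|tk] := eqVneq t k; first by rewrite tk yk eqxx in yt.
have := y0 t tW; rewrite big1 ?addr0 => [e|u /andP[uW ut]]; first by rewrite e eqxx in yt.
by rewrite Msupp ?mulr0 // !inE (negPf ti) (negPf tj) (negPf tk) /= ?orbT.
Qed.

(** For n > 2 adjacency is preserved because disjointness is; for n = 2 the
    image of a triangle lies in a 3-set by [clique_to_clique], where any two
    edges meet. Three pairwise adjacent edges form a triangle or a star. *)
Lemma triangle_to_triangle i j k : uniq [:: i; j; k] ->
  triangle (s (i, j)) (s (i, k)) (s (j, k)).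
Proof.
move=> u; move: (u); rewrite /= !inE negb_or andbT => /andP[/andP[ij ik] jk].
have oij : offdiag (i, j) by []. have oik : offdiag (i, k) by [].
have ojk : offdiag (j, k) by [].
have meet x y : offdiag x -> offdiag y -> x.1 \in [set i; j; k]%SET -> x.2 \in [set i; j; k]%SET ->
   y.1 \in [set i; j; k]%SET -> y.2 \in [set i; j; k]%SET ->
   ~~ [disjoint ends x & ends y] -> ~~ [disjoint ends (s x) & ends (s y)].
  move=> ox oy x1 x2 y1 y2; case: (ltnP 2 n) => n2.
    apply: contra; apply: (edge_perm_meet es) => // a b oa ob.
    exact: disjoint_to_disjoint.
  move=> _.
  have en : n = 2%N by apply/eqP; rewrite eqn_leq n2 n_gt1.
  have ck : (#|[set i; j; k]| <= n.+1 <= m)%N.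
    rewrite ltnm andbT en (leq_trans (leq_card_setU _ _)) // cards1 cards2.
    by rewrite ij.
  have [W /fintype.subsetP TW cW] := card_extend ck.
  have [W' cW' WW'] := clique_to_clique cW.
  have xW := ends_sub_clique WW' ox (TW _ x1) (TW _ x2).
  have yW := ends_sub_clique WW' oy (TW _ y1) (TW _ y2).
  apply/negP => d; have : (#|ends (s x) :|: ends (s y)| <= #|W'|)%N.
    by apply: subset_leq_card; rewrite finset.subUset xW yW.
  rewrite cW' en cardsU; move: (d); rewrite -finset.setI_eq0 => /eqP->.
  rewrite cards0 subn0 /ends !cards2.
  by rewrite -!/(offdiag _) !(es _).2 ox oy.
have share (t : 'I_m) (A B : {set 'I_m}) : t \in A -> t \in B -> ~~ [disjoint A & B].
  by move=> tA tB; apply/negP => /pred0P/(_ t); rewrite /= tA tB.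
apply: triangle_of_meeting; rewrite ?(es _).2 //.
- apply/eqP => /(edge_perm_ends es oij oik) [[ei]|[ei _]].
    by rewrite ei eqxx in jk.
  by rewrite ei eqxx in ik.
- by apply: meet; rewrite ?inE ?eqxx ?orbT //; apply: (share i); rewrite !inE eqxx ?orbT.
- by apply: meet; rewrite ?inE ?eqxx ?orbT //; apply: (share j); rewrite !inE eqxx ?orbT.
- by apply: meet; rewrite ?inE ?eqxx ?orbT //; apply: (share k); rewrite !inE eqxx ?orbT.
- by move=> b b1 b2 b3; exact: (no_star u b1 b2 b3).
Qed.

Lemma edge_perm_rigid : exists rho : 'I_m -> 'I_m, injective rho /\
  forall i j, i != j -> ends (s (i, j)) = [set rho i; rho j]%SET.
Proof.
apply: edge_perm_induced es triangle_to_triangle.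
exact: leq_ltn_trans n_gt1 ltnm.
Qed.

End Rigidity.

(** * Polynomial functions of a configuration *)

(** The inductive form gives one induction for each use: substitution,
    restriction to a line, and representation by a multivariate polynomial. *)
Inductive polyfun (R : comPzRingType) (n m : nat) : ('M[R]_(n, m) -> R) -> Prop :=
| polyfun_coord i j : polyfun (fun v => v i j)
| polyfun_const c : polyfun (fun=> c)
| polyfun_add F G : polyfun F -> polyfun G -> polyfun (fun v => F v + G v)
| polyfun_mul F G : polyfun F -> polyfun G -> polyfun (fun v => F v * G v).

Section Polyfun.
Variables (R : comPzRingType) (n m : nat).
Implicit Types F G : 'M[R]_(n, m) -> R.

Lemma eq_polyfun F G : F =1 G -> polyfun F -> polyfun G.
Proof. by move=> /funext->. Qed.

Lemma polyfun_sub F G : polyfun F -> polyfun G -> polyfun (fun v => F v - G v).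
Proof.
move=> pF pG; apply: (@eq_polyfun (fun v => F v + (-1) * G v)) => [v|].
  by rewrite mulN1r.
by apply: polyfun_add => //; apply: polyfun_mul => //; apply: polyfun_const.
Qed.

Lemma polyfun_sum I (r : seq I) (P : pred I) (F : I -> 'M[R]_(n, m) -> R) :
  (forall i, P i -> polyfun (F i)) -> polyfun (fun v => \sum_(i <- r | P i) F i v).
Proof.
move=> pF; elim: r => [|i r IH].
  by apply: eq_polyfun (polyfun_const _ _ 0) => v; rewrite big_nil.
case: (boolP (P i)) => [Pi|/negPf Pi].
  by apply: eq_polyfun (polyfun_add (pF i Pi) IH) => v; rewrite big_cons Pi.
by apply: eq_polyfun IH => v; rewrite big_cons Pi.
Qed.

Lemma polyfun_prod I (r : seq I) (P : pred I) (F : I -> 'M[R]_(n, m) -> R) :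
  (forall i, P i -> polyfun (F i)) -> polyfun (fun v => \prod_(i <- r | P i) F i v).
Proof.
move=> pF; elim: r => [|i r IH].
  by apply: eq_polyfun (polyfun_const _ _ 1) => v; rewrite big_nil.
case: (boolP (P i)) => [Pi|/negPf Pi].
  by apply: eq_polyfun (polyfun_mul (pF i Pi) IH) => v; rewrite big_cons Pi.
by apply: eq_polyfun IH => v; rewrite big_cons Pi.
Qed.

Lemma polyfun_det k (M : 'M[R]_(n, m) -> 'M[R]_k) :
  (forall i j, polyfun (fun v => M v i j)) -> polyfun (fun v => \det (M v)).
Proof.
move=> pM; apply: polyfun_sum => s _; apply: polyfun_mul; first exact: polyfun_const.
by apply: polyfun_prod => i _; apply: pM.
Qed.

Lemma polyfun_gram i j : polyfun (fun v : 'M[R]_(n, m) => (v^T *m v) i j).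
Proof.
apply: eq_polyfun (fun v => esym (gramE v i j)) _; apply: polyfun_sum => k _.
by apply: polyfun_mul; apply: polyfun_coord.
Qed.

End Polyfun.

Lemma polyfun_comp (R : comPzRingType) (n m n' m' : nat)
    (Phi : 'M[R]_(n, m) -> 'M[R]_(n', m')) (F : 'M[R]_(n', m') -> R) :
  (forall i j, polyfun (fun v => Phi v i j)) -> polyfun F -> polyfun (fun v => F (Phi v)).
Proof.
move=> pPhi; elim=> [i j|c|? ? _ pF _ pG|? ? _ pF _ pG]; first exact: pPhi.
- exact: polyfun_const.
- exact: polyfun_add.
- exact: polyfun_mul.
Qed.

Lemma polyfun_line (R : comNzRingType) (n m : nat) (F : 'M[R]_(n, m) -> R) a b :
  polyfun F -> exists q : {poly R}, forall t, F (a + t *: b) = q.[t].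
Proof.
elim=> [i j|c|? ? _ [p pE] _ [q qE]|? ? _ [p pE] _ [q qE]].
- exists ((a i j)%:P + (b i j) *: 'X) => t; rewrite !mxE !hornerE.
  by rewrite mulrC.
- by exists c%:P => t; rewrite hornerC.
- by exists (p + q) => t; rewrite hornerD pE qE.
- by exists (p * q) => t; rewrite hornerM pE qE.
Qed.

Lemma poly_nonroot (R : numDomainType) (q : {poly R}) :
  q != 0 -> exists t, q.[t] != 0.
Proof.
move=> q0; apply: contrapT => nr.
pose rs : seq R := [seq i%:R | i <- iota 0 (size q)].
have : (size rs < size q)%N.
  apply: max_poly_roots => //.
    by apply/allP => t _; apply/negPn/negP => qt; apply: nr; exists t.
  by rewrite map_inj_uniq ?iota_uniq // => i j /eqP; rewrite eqr_nat => /eqP.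
by rewrite size_map size_iota ltnn.
Qed.

(** Restricted to the line through a and b, both functions are nonzero
    one-variable polynomials, and so is their product. *)
Lemma polyfun_mul_neq0 (R : numDomainType) (n m : nat) (F G : 'M[R]_(n, m) -> R) a b :
  polyfun F -> polyfun G -> F a != 0 -> G b != 0 -> exists c, F c * G c != 0.
Proof.
move=> pF pG Fa Gb.
have [p pE] := polyfun_line a (b - a) pF; have [q qE] := polyfun_line a (b - a) pG.
have p0 : p != 0.
  apply: contra Fa => /eqP p0.
  by have := pE 0; rewrite scale0r addr0 p0 horner0 => ->.
have q0 : q != 0.
  apply: contra Gb => /eqP q0.
  by have := qE 1; rewrite scale1r addrC subrK q0 horner0 => ->.
have [|t] := @poly_nonroot _ (p * q); first by rewrite mulf_neq0.
by rewrite hornerM -pE -qE; exists (a + t *: (b - a)).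
Qed.

Lemma polyfun_common_nonzero (R : numDomainType) (n m : nat) (I : eqType) (r : seq I)
    (F : I -> 'M[R]_(n, m) -> R) :
    (forall i, polyfun (F i)) -> (forall i, i \in r -> exists a, F i a != 0) ->
  exists c, \prod_(i <- r) F i c != 0.
Proof.
move=> pF; elim: r => [|i r IH] Fn0; first by exists 0; rewrite big_nil oner_neq0.
have [|c cr] := IH; first by move=> j jr; apply: Fn0; rewrite inE jr orbT.
have [a ai] := Fn0 i (mem_head _ _).
have [d] := polyfun_mul_neq0 (pF i) (polyfun_prod r (P := xpredT) (fun j _ => pF j)) ai cr.
by exists d; rewrite big_cons.
Qed.

Section SphereMap.
Variables (R : rcfType) (n m : nat) (i0 i1 : 'I_n).
Hypothesis i01 : i1 != i0.

(** Up to sign, u |-> 2 <u, e> u - |u|^2 e is |u|^2 times the reflection of e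
    in the hyperplane orthogonal to u, a vector of length |u|^2. The factor in
    front gives all columns the same length. *)
Definition sphere_map (u : 'M[R]_(n, m)) : 'M[R]_(n, m) :=
  \matrix_(i, j) ((\prod_(k | k != j) (u^T *m u) k k) *
    (2 * u i0 j * u i j - (i == i0)%:R * (u^T *m u) j j)).

Lemma polyfun_sphere_map i j : polyfun (fun u => sphere_map u i j).
Proof.
apply: (@eq_polyfun _ _ _ (fun u => (\prod_(k | k != j) (u^T *m u) k k) *
    (2 * u i0 j * u i j - (i == i0)%:R * (u^T *m u) j j))) => [u|].
  by rewrite [RHS]mxE.
apply: polyfun_mul; first by apply: polyfun_prod => k _; apply: polyfun_gram.
apply: polyfun_sub; apply: polyfun_mul; try exact: polyfun_coord.
- by apply: polyfun_mul; [apply: polyfun_const|apply: polyfun_coord].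
- exact: polyfun_const.
- exact: polyfun_gram.
Qed.

Lemma sphere_map_norm u j :
  ((sphere_map u)^T *m sphere_map u) j j = (\prod_k (u^T *m u) k k) ^+ 2.
Proof.
rewrite gramE (bigD1 j) //= [in RHS]mulrC exprMn; set p := \prod_(k | _) _.
under eq_bigr do rewrite mxE -/p.
set N : R := (u^T *m u) j j.
rewrite (eq_bigr (fun k => p ^+ 2 * (4 * u i0 j ^+ 2 * (u k j * u k j) +
  (k == i0)%:R * (N ^+ 2 - 4 * u i0 j * N * u k j)))); last first.
  by move=> k _; case: eqP => [->|_] /=; ring.
rewrite -mulr_sumr; congr (_ * _); rewrite big_split /= -mulr_sumr -gramE -/N.
rewrite (bigD1 i0) //= eqxx big1 => [|k /negPf->]; last by rewrite mul0r.
by rewrite mul1r addr0; ring.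
Qed.

(** The reflection in the bisecting direction e + v, normalized, reaches v;
    for v = -e any unit vector orthogonal to e does. *)
Lemma sphere_map_onto v : unit_conf v -> exists u, sphere_map u = v.
Proof.
move=> v1.
have n1 j : \sum_i v i j * v i j = 1 by rewrite -gramE v1.
pose l j := 2 * (1 + v i0 j).
pose u : 'M[R]_(n, m) := \matrix_(i, j) if v i0 j == -1 then (i == i1)%:R
  else ((i == i0)%:R + v i j) / Num.sqrt (l j).
have lgt0 j : v i0 j != -1 -> 0 < l j.
  move=> vj; have : v i0 j * v i0 j <= 1.
    rewrite -(n1 j) (bigD1 i0) //= lerDl sumr_ge0 // => i _.
    by rewrite -expr2 sqr_ge0.
  move=> v2; have : v i0 j + 1 != 0 by rewrite addr_eq0.
  by rewrite /l => h; rewrite lt_def; apply/andP; split; [apply: contra h => /eqP|]; nra.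
have u1 j : (u^T *m u) j j = 1.
  rewrite gramE; have [vj|vj] := eqVneq (v i0 j) (-1).
    rewrite (bigD1 i1) //= big1 ?mxE ?vj ?eqxx ?mulr1 ?addr0 // => i /negPf ii.
    by rewrite mxE vj eqxx ii mul0r.
  rewrite (eq_bigr (fun i => (v i j * v i j + (i == i0)%:R * (1 + 2 * v i j)) / l j)).
    rewrite -mulr_suml big_split /= n1 (bigD1 i0) //= eqxx big1 => [|i /negPf->].
      have := lgt0 j vj; rewrite /l => ?.
      by rewrite mul1r addr0; field; rewrite gt_eqF //; lra.
    by rewrite mul0r.
  move=> i _; rewrite mxE (negPf vj) mulrACA -invfM -[X in _ / X]expr2.
  rewrite sqr_sqrtr; last exact/ltW/lgt0.
  by congr (_ / _); case: (i == i0); rewrite /= ?mul1r ?mul0r; ring.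
exists u; apply/matrixP => i j; rewrite mxE big1 ?mul1r ?u1 // mulr1 !mxE.
have [vj|vj] := eqVneq (v i0 j) (-1).
  rewrite [i0 == i1]eq_sym (negPf i01) mulr0 mul0r add0r.
  have [->|ii] := eqVneq i i0; first by rewrite vj.
  rewrite oppr0; have := n1 j; rewrite (bigD1 i0) //= vj mulrNN mulr1.
  move=> e; have s0 : \sum_(k | k != i0) v k j * v k j = 0 by lra.
  have /psumr_eq0P /(_ s0 i ii) /eqP :
      forall k, k != i0 -> 0 <= v k j * v k j by move=> k _; rewrite -expr2 sqr_ge0.
  by rewrite mulf_eq0 orbb => /eqP.
rewrite eqxx -mulrA mulrACA -invfM -[X in _ / X]expr2 sqr_sqrtr; last exact/ltW/lgt0.
have := lgt0 j vj; rewrite /l => ?.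
by case: (i == i0); rewrite /= ?mul1r ?mul0r; field; rewrite gt_eqF //; lra.
Qed.
End SphereMap.

(** Composition with [sphere_map] turns the conditions at different unit
    configurations into conditions on an affine space. *)
Lemma generic_equal_norm (R : rcfType) (n m : nat) (I : eqType) (r : seq I)
    (F : I -> 'M[R]_(n, m) -> R) : (1 < n)%N ->
    (forall i, polyfun (F i)) ->
    (forall i, i \in r -> exists2 v, unit_conf v & F i v != 0) ->
  exists v, (forall j j', (v^T *m v) j j = (v^T *m v) j' j') /\
    \prod_(i <- r) F i v != 0.
Proof.
move=> n1 pF Fn0; pose i0 := Ordinal (ltnW n1); pose i1 := Ordinal n1.
have i01 : i1 != i0 by [].
have [//||u un0] := @polyfun_common_nonzero R n m I r (fun i u => F i (sphere_map i0 u)).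
- by move=> i; apply: polyfun_comp (pF i); apply: polyfun_sphere_map.
- by move=> i /Fn0[v /(sphere_map_onto i01)[u <-]]; exists u.
by exists (sphere_map i0 u); split=> // j j'; rewrite !sphere_map_norm.
Qed.

Lemma polyfun_mpoly (R : comNzRingType) (n m : nat) (F : 'M[R]_(n, m) -> R) :
  polyfun F -> exists p : mpoly (n * m) R,
    forall v, F v = meval (mxvec v 0) p.
Proof.
elim=> [i j|c|? ? _ [p pE] _ [q qE]|? ? _ [p pE] _ [q qE]].
- exists (mpolyX R (mnm1 (mxvec_index i j))) => v.
  by rewrite mevalXU mxvecE.
- by exists (mpolyC _ c) => v; rewrite mevalC.
- by exists (p + q) => v; rewrite mevalD pE qE.
- by exists (p * q) => v; rewrite mevalM pE qE.
Qed.

(** * Generic configurations are determined by their Gram data *)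

Lemma perm_of_equal_fibers (T : finType) (V : eqType) (F G : T -> V) :
    (forall t, #|[set z | F z == t]| = #|[set z | G z == t]|) ->
  exists s : {perm T}, forall z, F z = G (s z).
Proof.
move=> FG.
pose f := [tuple F (enum_val i) | i < #|T|].
pose g := [tuple G (enum_val i) | i < #|T|].
have cE (H : T -> V) t : #|[set z | H z == t]| =
    count_mem t [tuple H (enum_val i) | i < #|T|].
  rewrite -sum1_card -sum1_count big_map big_enum_cond /=.
  rewrite (reindex (fun i : 'I_#|T| => enum_val i)) /=; last exact/onW_bij/enum_val_bij.
  by apply: eq_bigl => i; rewrite inE.
have /tuple_permP[p pE] : perm_eq f g.
  by apply/allP => t _ /=; rewrite -!cE FG.
pose s x := enum_val (p (enum_rank x)).
have sI : injective s by move=> x y /enum_val_inj/perm_inj/enum_rank_inj.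
exists (perm sI) => z; rewrite permE /s.
have /(congr1 (fun t => tnth t (enum_rank z))) := val_inj pE.
by rewrite !tnth_mktuple enum_rankK.
Qed.

(** With A and B the invertible square blocks of v and w selected by f, the map
    is B A^-1. *)
Lemma gram_eq_orthogonal (R : fieldType) (n m : nat) (f : 'I_n -> 'I_m)
    (v w : 'M[R]_(n, m)) : \det (colsub f v) != 0 -> w^T *m w = v^T *m v ->
  exists g : 'M[R]_n, g^T *m g = 1%:M /\ w = g *m v.
Proof.
move=> dA wv; set A := colsub f v; pose B := colsub f w.
have uA : A \in unitmx by rewrite unitmxE unitfE.
have subE (x : 'M[R]_(n, m)) : (colsub f x)^T *m x = rowsub f (x^T *m x).
  by apply/matrixP => i j; rewrite !mxE; apply: eq_bigr => k _; rewrite !mxE.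
have BA : B^T *m w = A^T *m v by rewrite !subE wv.
have subC k l (C : 'M[R]_(k, n)) (x : 'M[R]_(n, l)) (h : 'I_n -> 'I_l) :
    C *m colsub h x = colsub h (C *m x).
  by apply/matrixP => i j; rewrite !mxE; apply: eq_bigr => a _; rewrite mxE.
have BBAA : B^T *m B = A^T *m A by rewrite !subC BA.
have uB : B^T \in unitmx.
  have : B^T *m B \in unitmx by rewrite BBAA unitmx_mul unitmx_tr uA.
  by rewrite unitmx_mul => /andP[].
exists (B *m invmx A).
have gg : (B *m invmx A)^T *m (B *m invmx A) = 1%:M.
  rewrite trmx_mul trmx_inv !mulmxA -[_ *m B^T *m B]mulmxA BBAA.
  by rewrite mulmxA mulVmx ?unitmx_tr // mul1mx mulmxV.
split=> //; apply: (can_inj (mulKmx uB)); rewrite BA !mulmxA BBAA.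
by rewrite -[_ *m A *m _]mulmxA mulmxV // mulmx1.
Qed.

Lemma singular_of_det (R : idomainType) (m : nat) (W : {set 'I_m})
    (M : 'I_m * 'I_m -> R) :
  \det (\matrix_(a < #|W|, b < #|W|) M (enum_val a, enum_val b)) = 0 ->
  singular_on W M.
Proof.
move/eqP/det0P => [x x0 xM].
pose y i := \sum_(a < #|W|) (enum_val a == i)%:R * x 0 a.
have yE a : y (enum_val a) = x 0 a.
  rewrite /y (bigD1 a) //= eqxx mul1r big1 ?addr0 // => b ba.
  by rewrite (inj_eq enum_val_inj) (negPf ba) mul0r.
exists y; split.
  have /rV0Pn[a xa] := x0.
  by exists (enum_val a); rewrite ?enum_valP // yE.
move=> j jW; rewrite (big_enum_val (fun i => y i * M (i, j))).
move/rowP/(_ (enum_rank_in jW j)): xM; rewrite !mxE => xM; rewrite -[RHS]xM.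
by apply: eq_bigr => a _; rewrite yE mxE enum_rankK_in.
Qed.

Section Genericity.
Variables (R : rcfType) (n m : nat).
Local Notation P := ('I_m * 'I_m)%type.

Definition gram (v : 'M[R]_(n, m)) (z : P) : R := (v^T *m v) z.1 z.2.

Definition sqnorms (v : 'M[R]_(n, m)) (z : P) : R := gram v (z.1, z.1) + gram v (z.2, z.2).

(** Three kinds of polynomials must not vanish: maximal minors of v, which make
    the orthogonal map between configurations unique, differences of inner
    products, and (n+1)-minors of permuted Gram matrices. *)
Definition test_index : Type := ({ffun 'I_n -> 'I_m} + P * P) + ({perm P} * {set 'I_m}).

Definition test_fun (x : test_index) (v : 'M[R]_(n, m)) : R :=
  match x with
  | inl (inl f) => \det (colsub f v)
  | inl (inr (y, z)) => gram v y - gram v z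
  | inr (s, W) =>
      \det (\matrix_(a < #|W|, b < #|W|) gram v (s (enum_val a, enum_val b)))
  end.

(** Some of the test functions vanish at every unit configuration, like the
    minors of an unpermuted Gram matrix; genericity at v lets one recognize
    them by their value at v alone. *)
Definition generic (v : 'M[R]_(n, m)) :=
  forall x, (exists2 u, unit_conf u & test_fun x u != 0) -> test_fun x v != 0.

Lemma polyfun_test x : polyfun (test_fun x).
Proof.
case: x => [[f|[y z]]|[s W]]; rewrite /test_fun /gram.
- apply: polyfun_det => i j; apply: eq_polyfun (polyfun_coord _ i (f j)) => v.
  by rewrite mxE.
- by apply: polyfun_sub; apply: polyfun_gram.
apply: polyfun_det => a b.
by apply: eq_polyfun (polyfun_gram _ _ _ _) => v; rewrite [RHS]mxE.
Qed.

Lemma exists_generic : (1 < n)%N -> exists F : 'M[R]_(n, m) -> R,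
  [/\ polyfun F, forall v, F v != 0 -> generic v &
     exists v, (forall j j', (v^T *m v) j j = (v^T *m v) j' j') /\ F v != 0].
Proof.
move=> n1; pose good x := `[< exists2 u, unit_conf u & test_fun x u != 0 >].
pose r := [seq x <- enum {: ({ffun 'I_n -> 'I_m} + P * P) + ({perm P} * {set 'I_m})} | good x].
have rE x : (x \in r) = good x by rewrite mem_filter mem_enum andbT.
exists (fun v => \prod_(x <- r) test_fun x v); split.
- by apply: polyfun_prod => x _; apply: polyfun_test.
- move=> v; rewrite prodf_seq_neq0 => /allP vr x gx.
  by apply: (implyP (vr x _)) => //; rewrite rE; apply/asboolP.
apply: generic_equal_norm => // [x|x]; first exact: polyfun_test.
by rewrite rE => /asboolP.
Qed.

Lemma gramC v i j : gram v (i, j) = gram v (j, i).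
Proof. by rewrite /gram !gramE; apply: eq_bigr => k _; rewrite mulrC. Qed.

Lemma gram_flip v z : gram v (flip z) = gram v z.
Proof. by case: z => i j; rewrite gramC. Qed.

(** All points sit at one basis vector, except k, which sits at another. *)
Lemma unit_basis_conf (i0 i1 : 'I_n) (k : 'I_m) : i0 != i1 ->
  exists2 u : 'M[R]_(n, m), unit_conf u &
    forall i j, gram u (i, j) = ((i == k) == (j == k))%:R.
Proof.
move=> i01; pose c j := if j == k then i1 else i0.
pose u : 'M[R]_(n, m) := \matrix_(i, j) (i == c j)%:R.
have uE i j : gram u (i, j) = (c i == c j)%:R.
  rewrite /gram gramE (bigD1 (c i)) //= !mxE eqxx mul1r big1 ?addr0 // => l li.
  by rewrite !mxE (negPf li) mul0r.
exists u => [i|i j]; first by rewrite -[LHS]/(gram u (i, i)) uE eqxx.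
rewrite uE /c; case: (i == k); case: (j == k); rewrite ?eqxx //.
  by rewrite eq_sym (negPf i01).
by rewrite (negPf i01).
Qed.

(** For distinct edges, moving an end of y that is not an end of z separates
    their inner products. *)
Lemma generic_gram_inj v y z : (1 < n)%N -> generic v -> offdiag y -> offdiag z ->
  gram v y = gram v z -> ends y = ends z.
Proof.
move=> n1 gv oy oz yz; apply/eqP; rewrite eqEcard !cards2 -!/(offdiag _) oy oz andbT.
apply/negPn/negP => /subsetPn[k ky kz].
have [u u1 uE] := @unit_basis_conf (Ordinal (ltnW n1)) (Ordinal n1) k isT.
have /negP[] : test_fun (inl (inr (y, z))) v != 0; last by rewrite /= yz subrr.
apply: gv; exists u => //=.
have [kz1 kz2] : k != z.1 /\ k != z.2 by move: kz; rewrite !inE negb_or => /andP[].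
have -> : gram u z = 1.
  by rewrite [z]surjective_pairing uE ![_ == k]eq_sym (negPf kz1) (negPf kz2) eqxx.
have -> : gram u y = 0.
  case/endsP: ky oy => a [] ->; rewrite /offdiag /= uE eqxx => ak.
    by rewrite [a == k]eq_sym (negPf ak).
  by rewrite (negPf ak).
by rewrite sub0r oppr_eq0 oner_neq0.
Qed.

(** The right-hand side is |v_i - v_j|^2, so that the Gram data of a pair tell
    whether it is diagonal. *)
Lemma sqnorms_sub_gram v z :
  sqnorms v z - 2 * gram v z = \sum_k (v k z.1 - v k z.2) ^+ 2.
Proof.
rewrite /sqnorms /gram !gramE mulr_sumr -big_split -sumrB /=.
by apply: eq_bigr => k _; ring.
Qed.

Lemma offdiag_sqnorms v z : injective (fun i => col i v) ->
  offdiag z = (sqnorms v z - 2 * gram v z != 0).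
Proof.
move=> vI; rewrite sqnorms_sub_gram; congr negb; apply/eqP/eqP => [->|s0].
  by rewrite big1 // => k _; rewrite subrr expr0n.
apply: vI; apply/colP => k; rewrite !mxE; apply/eqP; rewrite -subr_eq0 -sqrf_eq0.
apply/eqP; apply: (psumr_eq0P _ s0) => // i _; exact: sqr_ge0.
Qed.

Lemma generic_distinct v : (1 < n)%N -> (2 < m)%N -> generic v ->
  injective (fun i => col i v).
Proof.
move=> n1 m2 gv i j ij; apply/eqP/negPn/negP => nij.
have [k /andP[ki kj]] := exists_third i j m2.
have oik : offdiag (i, k) by rewrite /offdiag eq_sym.
have ojk : offdiag (j, k) by rewrite /offdiag eq_sym.
have : gram v (i, k) = gram v (j, k).
  rewrite /gram !gramE; apply: eq_bigr => l _ /=; congr (_ * _).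
  by move/colP/(_ l): ij; rewrite !mxE.
move/(generic_gram_inj n1 gv oik ojk)/(eq_ends oik ojk) => [[e]|[e _]].
  by rewrite e eqxx in nij.
by rewrite e eqxx in ki.
Qed.

Lemma gram_minor_eq0 (w : 'M[R]_(n, m)) (W : {set 'I_m}) : (n < #|W|)%N ->
  \det (\matrix_(a < #|W|, b < #|W|) gram w (enum_val a, enum_val b)) = 0.
Proof.
move=> nW; set M := \matrix_(a, b) _.
have -> : M = (colsub enum_val w)^T *m colsub enum_val w.
  apply/matrixP => a b; rewrite mxE /gram gramE [RHS]gramE.
  by apply: eq_bigr => k _; rewrite !mxE.
apply/eqP/negPn; rewrite -unitfE -unitmxE -row_free_unit -row_leq_rank -ltnNge.
apply: leq_ltn_trans nW; apply: leq_trans (mxrankM_maxr _ _) (rank_leq_row _).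
Qed.

Lemma generic_determined (v w : 'M[R]_(n, m)) (s : {perm P}) :
    (1 < n)%N -> (n < m)%N -> generic v -> injective (fun i => col i w) ->
    (forall z, gram w z = gram v (s z)) ->
    (forall z, sqnorms w z = sqnorms v (s z)) ->
  exists (g : 'M[R]_n) (rho : {perm 'I_m}),
    g^T *m g = 1%:M /\ forall i, col i w = g *m col (rho i) v.
Proof.
move=> n1 nm gv wI gs ns; have m2 : (2 < m)%N by apply: leq_ltn_trans nm.
have vI := generic_distinct n1 m2 gv.
have os z : offdiag (s z) = offdiag z.
  by rewrite (offdiag_sqnorms _ vI) (offdiag_sqnorms _ wI) gs ns.
have es : edge_perm s.
  move=> z; split; last exact: os.
  have [oz|] := boolP (offdiag z); last first.
    move=> nz; move: (nz); rewrite -(os z) !negbK => /eqP sz.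
    move/negPn/eqP: nz => zz; have -> : flip z = z by rewrite /flip zz; case: (z) zz => ? ? /= ->.
    by rewrite /flip sz; case: (s z) sz => ? ? /= ->.
  have ofz : offdiag (flip z) by rewrite /offdiag eq_sym.
  have : ends (s (flip z)) = ends (s z).
    by apply: (generic_gram_inj n1 gv); rewrite ?os // -!gs gram_flip.
  case/eq_ends; rewrite ?os // => /perm_inj e.
  by move: oz; rewrite /offdiag -{1}e eqxx.
have sing (W : {set 'I_m}) (u : 'M[R]_(n, m)) : #|W| = n.+1 -> unit_conf u ->
    singular_on W (fun z => (u^T *m u) (s z).1 (s z).2).
  move=> cW u1; apply: singular_of_det; apply/eqP/negPn/negP => d0.
  have /negP[] : test_fun (inr (s, W)) v != 0 by apply: gv; exists u.
  rewrite /= -[X in \det X](_ : (\matrix_(a, b) gram w (enum_val a, enum_val b)) = _).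
    by rewrite gram_minor_eq0 // cW.
  by apply/matrixP => a b; rewrite !mxE gs.
have [rho [rhoI rhoE]] := edge_perm_rigid n1 nm es sing.
have sE i j : i != j -> s (i, j) = (rho i, rho j) \/ s (i, j) = flip (rho i, rho j).
  move=> ij; apply: eq_ends; rewrite ?os ?rhoE //.
  by rewrite /offdiag (inj_eq rhoI).
have goff i j : i != j -> gram w (i, j) = gram v (rho i, rho j).
  by move=> ij; rewrite gs; case: (sE i j ij) => ->; rewrite ?gram_flip.
have noff i j : i != j -> sqnorms w (i, j) = sqnorms v (rho i, rho j).
  by move=> ij; rewrite ns; case: (sE i j ij) => -> //; rewrite /sqnorms addrC.
(* The sums of squared norms over the sides of a triangle give each norm. *)
have gdiag i : gram w (i, i) = gram v (rho i, rho i).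
  have [j /andP[ji _]] := exists_third i i m2.
  have [k /andP[ki kj]] := exists_third i j m2.
  rewrite eq_sym in ji; rewrite eq_sym in ki; rewrite eq_sym in kj.
  move: (noff i j ji) (noff i k ki) (noff j k kj); rewrite /sqnorms /=; lra.
have gall i j : gram w (i, j) = gram v (rho i, rho j).
  by have [->|/goff] := eqVneq i j.
pose r := perm rhoI.
pose w' := colsub (r^-1)%g w.
have w'v : w'^T *m w' = v^T *m v.
  apply/matrixP => i j; rewrite -[RHS]/(gram v (i, j)).
  have -> : gram v (i, j) = gram w (((r^-1)%g i), ((r^-1)%g j)).
    by rewrite gall -!(permE rhoI) !permKV.
  by rewrite /gram !gramE; apply: eq_bigr => k _; rewrite !mxE.
(* The first n columns of v are independent, since the test function of f is
   1 when these columns are the standard basis. *)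
pose f := [ffun i : 'I_n => widen_ord (ltnW nm) i].
have df : \det (colsub f v) != 0.
  apply: (gv (inl (inl f))); pose i0 := Ordinal (ltnW n1).
  exists (\matrix_(i, j) (i == odflt i0 (insub (nat_of_ord j)))%:R).
    move=> j; rewrite gramE (bigD1 (odflt i0 (insub (nat_of_ord j)))) //= mxE eqxx mul1r.
    by rewrite big1 ?addr0 // => i /negPf ij; rewrite !mxE ij mul0r.
  rewrite /= (_ : colsub f _ = 1%:M) ?det1 ?oner_neq0 //.
  apply/matrixP => i j; rewrite !mxE ffunE /=.
  by rewrite insubT //=; congr (_ == _)%:R; apply: val_inj.
have [g [gg wg]] := gram_eq_orthogonal df w'v.
exists g, r; split=> // i.
have -> : col i w = col (r i) w' by apply/colP => k; rewrite !mxE permK.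
by rewrite wg; apply/colP => k; rewrite !mxE; apply: eq_bigr => l _; rewrite !mxE.
Qed.
End Genericity.

(** * Second moments of sums of Dirac masses *)

Local Open Scope classical_set_scope.
Local Open Scope ring_scope.

Section SecondMoment.
Variables (R : realType) (n m : nat).
Implicit Types v w : 'M[R]_(n, m).

Lemma binary_deltaE v (A : set (borel_mx R n 1)) :
  binary_delta v A = (\sum_(i < m) ((col i v : borel_mx R n 1) \in A)%:R)%:E.
Proof. by rewrite -sumEFin; apply: eq_bigr => i _; rewrite diracE. Qed.

Lemma orth_act_binary_delta (g : 'M[R]_n) v :
  orth_act g (binary_delta v) = binary_delta (g *m v).
Proof.
apply/funext => A; rewrite /orth_act /pushforward !binary_deltaE.
congr (_%:E); apply: eq_bigr => i _; congr ((nat_of_bool _)%:R).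
have -> : (col i (g *m v) : borel_mx R n 1) = g *m col i v.
  by apply/colP => k; rewrite !mxE; apply: eq_bigr => l _; rewrite !mxE.
by apply/idP/idP; rewrite !inE.
Qed.

Lemma binary_delta_msum v : exists m_ : (measure (borel_mx R n 1) R)^nat,
  binary_delta v = msum m_ m /\ forall i : 'I_m, m_ i = \d_(col i v : borel_mx R n 1).
Proof.
pose c (k : nat) : borel_mx R n 1 := if insub k is Some i then col i v else 0.
have cE (i : 'I_m) : c i = col i v by rewrite /c valK.
exists (fun k => \d_(c k)); split=> [|i]; last by rewrite cE.
by apply/funext => A; apply: eq_bigr => i _ /=; rewrite cE.
Qed.

Lemma integral_binary_delta v (f : borel_mx R n 1 -> \bar R) :
    (forall x, (0 <= f x)%E) -> measurable_fun setT f ->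
  (\int[binary_delta v]_x f x = \sum_(i < m) f (col i v))%E.
Proof.
move=> f0 mf; have [m_ [-> mE]] := binary_delta_msum v.
rewrite ge0_integral_measure_sum //; apply: eq_bigr => i _.
by rewrite mE integral_dirac // diracE in_setT mul1e.
Qed.

Lemma product_binary_delta v (A : set (borel_mx R n 1 * borel_mx R n 1)) :
    measurable A ->
  ((binary_delta v \x binary_delta v) A)%E =
  (#|[set z : 'I_m * 'I_m | (col z.1 v : borel_mx R n 1, col z.2 v : borel_mx R n 1) \in A]|%SET%:R)%:E.
Proof.
move=> mA; rewrite /product_measure1 integral_binary_delta.
- under eq_bigr do rewrite /= binary_deltaE.
  rewrite sumEFin pair_bigA /= -sum1_card natr_sum; congr (_%:E).
  rewrite [RHS]big_mkcond /=; apply: eq_bigr => -[i j] _ /=.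
  by rewrite finset.inE mem_xsection /=; case: ifP.
- by move=> x /=; rewrite binary_deltaE lee_fin sumr_ge0.
apply: emeasurable_sum => i /=.
rewrite (_ : (fun _ => _) = EFin \o (\1_(ysection A (col i v : borel_mx R n 1)) : _ -> R)).
  by apply/measurable_EFinP/measurable_indic; apply: measurable_ysection.
by apply/funext => x /=; rewrite diracE indicE mem_xsection mem_ysection.
Qed.

Lemma measurable_coord (p q : nat) (i : 'I_p) (j : 'I_q) :
  measurable_fun setT (fun M : borel_mx R p q => (M : 'M[R]_(p, q)) i j).
Proof.
apply: (measurability _ (RGenOpens.measurableE R)) => _ [_ [a [b ->]] <-].
rewrite setTI; apply: sub_sigma_algebra.
have /continuousP := @coord_continuous R p q i j; apply.
exact: interval_open.
Qed.

Lemma measurable_orthogonal_group : measurable (@orthogonal_group R n).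
Proof.
rewrite (_ : @orthogonal_group R n = \bigcap_(z in [set: 'I_n * 'I_n])
   (fun g : borel_mx R n n => ((g : 'M[R]_n)^T *m g) z.1 z.2) @^-1` [set (1%:M : 'M[R]_n) z.1 z.2]).
  apply: fin_bigcap_measurable => // -[i j] _ /=.
  rewrite -[X in measurable X]setTI; apply: (_ : measurable_fun _ _) => //.
  rewrite (_ : (fun _ => _) = (fun g : borel_mx R n n =>
      \sum_k (g : 'M[R]_n) k i * (g : 'M[R]_n) k j)).
    by apply: measurable_sum => k; apply: measurable_funM; apply: measurable_coord.
  by apply/funext => g; rewrite gramE.
apply/seteqP; split=> g /=; first by move=> gg z _ /=; rewrite gg.
by move=> gg; apply/matrixP => i j; apply: (gg (i, j)).
Qed.

(** These sets are invariant under O(n), so that averaging over the group does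
    not change their measure. *)
Definition moment_level (c d : R) : set (borel_mx R n 1 * borel_mx R n 1) :=
  [set x | \sum_k (x.1 : 'cV[R]_n) k 0 * (x.2 : 'cV[R]_n) k 0 = c /\
    \sum_k (x.1 : 'cV[R]_n) k 0 * (x.1 : 'cV[R]_n) k 0 +
    \sum_k (x.2 : 'cV[R]_n) k 0 * (x.2 : 'cV[R]_n) k 0 = d].

Lemma measurable_moment_level c d : measurable (moment_level c d).
Proof.
have m1 k : measurable_fun setT
    (fun x : borel_mx R n 1 * borel_mx R n 1 => (x.1 : 'cV[R]_n) k 0).
  exact: (measurableT_comp (measurable_coord k 0) measurable_fst).
have m2 k : measurable_fun setT
    (fun x : borel_mx R n 1 * borel_mx R n 1 => (x.2 : 'cV[R]_n) k 0).
  exact: (measurableT_comp (measurable_coord k 0) measurable_snd).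
rewrite /moment_level -[X in measurable X]/(_ @^-1` [set c] `&` _ @^-1` [set d]).
apply: measurableI; rewrite -[X in measurable X]setTI; apply: (_ : measurable_fun _ _) => //.
- by apply: measurable_sum => k; apply: measurable_funM.
- by apply: measurable_funD; apply: measurable_sum => k; apply: measurable_funM.
Qed.

Lemma in_moment_level v i j c d :
  ((col i v : borel_mx R n 1, col j v : borel_mx R n 1) \in moment_level c d) =
  ((gram v (i, j), sqnorms v (i, j)) == (c, d)).
Proof.
have E a b : \sum_k (col a v) k 0 * (col b v) k 0 = gram v (a, b).
  by rewrite /gram gramE; apply: eq_bigr => k _; rewrite !mxE.
apply/idP/eqP; rewrite inE /moment_level /= !E /sqnorms; first by case=> -> ->.
by case=> -> ->.
Qed.

Lemma second_moment_level (mu : probability (borel_mx R n n) R) v c d :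
    mu (@orthogonal_group R n) = 1%E ->
  second_moment mu (binary_delta v) (moment_level c d) =
  (#|[set z : 'I_m * 'I_m | (gram v z, sqnorms v z) == (c, d)]|%SET%:R)%:E.
Proof.
move=> mu1; rewrite /second_moment.
rewrite (eq_integral (cst (#|[set z : 'I_m * 'I_m | (gram v z, sqnorms v z) == (c, d)]|%SET%:R)%:E)).
  rewrite integral_cst; last exact: measurable_orthogonal_group.
  by rewrite -[RHS]mule1; congr (_ * _)%E; exact: mu1.
move=> g /set_mem gg; rewrite orth_act_binary_delta product_binary_delta; last first.
  exact: measurable_moment_level.
congr (_%:R%:E); apply: eq_card => -[i j]; rewrite !finset.inE in_moment_level /=.
have E z : gram (g *m v) z = gram v z.
  by rewrite /gram trmx_mul -mulmxA (mulmxA g^T) gg mul1mx.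
by rewrite /sqnorms !E.
Qed.

Lemma binary_delta_colperm (rho : {perm 'I_m}) v w :
  (forall i, col i w = col (rho i) v) -> binary_delta w = binary_delta v.
Proof.
move=> wv; apply/funext => A; rewrite !binary_deltaE; congr (_%:E).
rewrite [RHS](reindex_inj (@perm_inj _ rho)) /=.
by apply: eq_bigr => i _; rewrite wv.
Qed.

(** The mass of a singleton tells whether it contains a point. *)
Lemma binary_delta_inj v w : distinct_conf w -> binary_delta w = binary_delta v ->
  exists rho : {perm 'I_m}, forall i, col i w = col (rho i) v.
Proof.
move=> dw wv.
have H i : exists j, col i w = col j v.
  apply: contrapT => nj; move/(congr1 (fun x => x [set (col i w : borel_mx R n 1)])): wv.
  rewrite !binary_deltaE => -[]; rewrite [RHS]big1 => [|j _]; last first.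
    by rewrite memNset //= => e; apply: nj; exists j.
  rewrite (bigD1 i) //= mem_set // => /eqP.
  by rewrite paddr_eq0 ?sumr_ge0 // oner_eq0.
have [rho rhoE] := boolp.choice H.
have rhoI : injective rho by move=> i j e; apply: dw; rewrite !rhoE e.
by exists (perm rhoI) => i; rewrite permE.
Qed.

(** Its preimage is the union of the nonvanishing loci of F after permutations
    of the points. *)
Lemma zariski_open_polyfun (F : 'M[R]_(n, m) -> R) : polyfun F ->
  zariski_open_delta m
    [set x | exists v, [/\ distinct_conf v, x = binary_delta v & F v != 0]].
Proof.
move=> pF; split=> [_ [v [dv -> _]]|]; first by exists v.
exists [set v | forall rho : {perm 'I_m}, F (col_perm rho v) = 0]; split.
  exists [set p | exists rho : {perm 'I_m}, forall v, F (col_perm rho v) = meval (mxvec v 0) p].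
  apply/seteqP; split=> v /= H; first by move=> p [rho <-].
  move=> rho; have [|p pE] := @polyfun_mpoly _ _ _ (fun v => F (col_perm rho v)).
    apply: polyfun_comp pF => i j; apply: eq_polyfun (polyfun_coord _ i (rho j)) => x.
    by rewrite mxE.
  by rewrite pE; apply: H; exists rho.
apply/seteqP; split=> v /=.
  move=> [dv [w [dw wv Fw]]]; split=> // H.
  have [rho rhoE] := binary_delta_inj dw (esym wv).
  have := H rho; rewrite (_ : col_perm rho v = w) => [/eqP|]; first by rewrite (negPf Fw).
  by apply/matrixP => i j; move/colP/(_ i): (rhoE j); rewrite !mxE.
move=> [dv] /existsNP[rho Fv]; split=> //; exists (col_perm rho v).
have colE i : col i (col_perm rho v) = col (rho i) v by apply/colP => k; rewrite !mxE.
split; last exact/eqP.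
  by move=> i j; rewrite !colE => /dv/perm_inj.
by symmetry; apply: binary_delta_colperm colE.
Qed.

End SecondMoment.

Theorem theorem1 (R : realType) (m n l : nat) :
  (n < m)%N -> (2 <= n)%N -> (l <= m)%N ->
  exists U : set (distr R n),
    [/\ zariski_open_eqmag m l U,
        U !=set0 &
        forall mu : probability (borel_mx R n n) R, haar_orthogonal mu ->
        forall x, U x ->
        forall y, delta_space m y ->
          (forall A, measurable A -> second_moment mu y A = second_moment mu x A) ->
          exists g : 'M[R]_n, orthogonal_group g /\ y = orth_act g x].
Proof.
move=> nm n1 lm; have m2 : (2 < m)%N by apply: leq_ltn_trans nm.
have [F [pF gF [v0 [v0n Fv0]]]] := exists_generic R m n1.
pose O := [set x : distr R n | exists v : 'M[R]_(n, m),
  [/\ distinct_conf v, x = binary_delta v & F v != 0]].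
have dv0 : distinct_conf v0 by apply: generic_distinct (gF _ Fv0).
exists (O `&` delta_space_eqmag m l); split.
- by exists O; split=> //; apply: zariski_open_polyfun.
- exists (binary_delta v0); split; first by exists v0.
  exists v0 => //; split=> //; exists [set: 'I_m]%SET; split=> [|i j _ _].
    by rewrite cardsT card_ord.
  have E k : \sum_i (col k v0) i 0 ^+ 2 = (v0^T *m v0) k k.
    by rewrite gramE; apply: eq_bigr => a _; rewrite mxE expr2.
  by rewrite /magnitude !E (v0n i j).
move=> mu [mu1 _] x [[v [dv -> Fv]] _] _ [w dw <-] H.
have [s sE] : exists s : {perm 'I_m * 'I_m},
    forall z, (gram w z, sqnorms w z) = (gram v (s z), sqnorms v (s z)).
  apply: (@perm_of_equal_fibers _ (R * R)%type (fun z => (gram w z, sqnorms w z))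
    (fun z => (gram v z, sqnorms v z))) => -[c d].
  have := H _ (measurable_moment_level (n := n) c d).
  by rewrite !second_moment_level // => -[/eqP]; rewrite eqr_nat => /eqP.
have [||g [rho [gg wE]]] := @generic_determined R n m v w s n1 nm (gF _ Fv) dw.
- by move=> z; case: (sE z).
- by move=> z; case: (sE z).
exists g; split=> //; rewrite orth_act_binary_delta.
apply: (@binary_delta_colperm _ _ _ rho) => i; rewrite wE.
by apply/colP => k; rewrite !mxE; apply: eq_bigr => a _; rewrite !mxE.
Qed.
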